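(* Let $X$ be a $2$-dimensional polyhedron. If $X$ is collapsible, then $X$ can be embedded in a product of two trees.
   Context: A polyhedron is the underlying space $|K|$ of a finite regular CW complex $K$. A graph is a 1-dimensional polyhedron; a tree is a connected graph containing no simple closed curve. An elementary collapse of a finite regular CW complex $K$ onto a subcomplex $L$ is the removal from $K$ of two cells $\sigma,\tau$, where $\tau$ is a face of $\sigma$ with $\dim\sigma=\dim\tau+1$ and $\sigma$ is the only cell of $K$ properly containing $\tau$. $X$ is collapsible if $X=|K|$ for some finite regular CW complex $K$ that can be reduced to a single vertex by a finite sequence of elementary collapses. *)

(* Defs.v *)
From HB Require Import structures.
From Stdlib Require Export Relation_Operators.
From mathcomp Require Export all_boot all_order all_algebra.
From mathcomp Require Export all_classical all_reals all_analysis.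

Set Implicit Arguments.
Unset Strict Implicit.
Unset Printing Implicit Defensive.
Import Order.TTheory GRing.Theory Num.Theory.
Import numFieldNormedType.Exports.

Local Open Scope classical_set_scope.
Local Open Scope ring_scope.

(* The restriction of f to A is a homeomorphism of A onto f @` A, both with
   the subspace topology. *)
Definition embedding_on (T U : topologicalType) (A : set T) (f : T -> U) :=
  [/\ {within A, continuous f}, set_inj A f &
      forall O : set T, open O ->
        exists2 V : set U, open V & A `&` O = A `&` f @^-1` V].

(* Squared Euclidean norm; the library's norm on 'rV[R]_n is the sup norm. *)
Definition sqnorm (R : realType) (n : nat) (x : 'rV[R]_n) : R :=
  \sum_(i < n) x ord0 i ^+ 2.

Definition closed_disc (R : realType) (n : nat) : set 'rV[R]_n :=
  [set x | sqnorm x <= 1].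

Definition open_disc (R : realType) (n : nat) : set 'rV[R]_n :=
  [set x | sqnorm x < 1].

Definition unit_sphere (R : realType) (n : nat) : set 'rV[R]_n :=
  [set x | sqnorm x = 1].

Arguments closed_disc R n : clear implicits.
Arguments open_disc R n : clear implicits.
Arguments unit_sphere R n : clear implicits.

(* K : regular_cw R X is a finite regular CW complex with |K| = X.  As there are
   finitely many cells and X is Hausdorff, closure-finiteness and the weak
   topology condition hold automatically.  Only the restriction of char_map c to
   the closed disc is meaningful. *)
Record regular_cw (R : realType) (X : topologicalType) := RegularCW {
  cell :> finType;
  cell_dim : cell -> nat;
  char_map : forall c : cell, 'rV[R]_(cell_dim c) -> X;
  cw_hausdorff : hausdorff_space X;
  char_map_embedding : forall c : cell,
    embedding_on (closed_disc R (cell_dim c)) (@char_map c);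
  open_cells_cover : forall x : X,
    exists c : cell, (@char_map c @` open_disc R (cell_dim c)) x;
  open_cells_disjoint : forall (c d : cell) (x : X),
    (@char_map c @` open_disc R (cell_dim c)) x ->
    (@char_map d @` open_disc R (cell_dim d)) x -> c = d;
  cell_boundary : forall c : cell,
    @char_map c @` unit_sphere R (cell_dim c) `<=`
    \bigcup_(d in [set d : cell | (cell_dim d < cell_dim c)%N])
      (@char_map d @` open_disc R (cell_dim d))
}.

Section Collapse.
Variables (R : realType) (X : topologicalType) (K : regular_cw R X).

Definition open_cell (c : K) : set X := char_map (c := c) @` open_disc R (cell_dim c).

Definition closed_cell (c : K) : set X :=
  char_map (c := c) @` closed_disc R (cell_dim c).

Definition has_dim (n : nat) : Prop :=
  (forall c : K, (cell_dim c <= n)%N) /\ exists c : K, cell_dim c = n.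

Definition face (t s : K) : Prop := closed_cell t `<=` closed_cell s.

Definition subcomplex (L : {set K}) : Prop :=
  forall c : K, c \in L ->
    closed_cell c `<=` \bigcup_(d in [set d : K | d \in L]) open_cell d.

Definition elementary_collapse (A B : {set K}) : Prop :=
  subcomplex A /\ subcomplex B /\
  exists s t : K,
    [/\ s \in A, t \in A, face t s & cell_dim s = (cell_dim t).+1] /\
    (forall c : K, c \in A -> closed_cell t `<` closed_cell c -> c = s) /\
    B = (A :\: [set s; t])%SET.

Definition collapses : {set K} -> {set K} -> Prop :=
  clos_refl_trans_1n {set K} elementary_collapse.

End Collapse.

Definition polyhedron_of_dim (R : realType) (n : nat) (X : topologicalType) : Prop :=
  exists K : regular_cw R X, has_dim K n.

(* The complex witnessing collapsibility is unrelated to the one witnessing the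
   dimension of X. *)
Definition collapsible (R : realType) (X : topologicalType) : Prop :=
  exists (K : regular_cw R X) (v : K),
    cell_dim v = 0%N /\ collapses [set: K]%SET [set v]%SET.

Definition graph (R : realType) (T : topologicalType) : Prop :=
  polyhedron_of_dim R 1 T.

Definition has_simple_closed_curve (R : realType) (T : topologicalType) : Prop :=
  exists f : 'rV[R]_2 -> T, embedding_on (unit_sphere R 2) f.

Definition tree (R : realType) (T : topologicalType) : Prop :=
  [/\ graph R T, connected [set: T] & ~ has_simple_closed_curve R T].

Definition embeds_in (X Y : topologicalType) : Prop :=
  exists f : X -> Y, embedding_on [set: X] f.

(* Main.v *)
Require Import Defs.
From mathcomp Require Import all_boot all_order all_algebra.
From mathcomp Require Import all_classical all_reals all_analysis.
From mathcomp Require Import lra ring.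

(** The proof runs the collapse backwards: starting from a vertex, cells are
    glued back two at a time, and at every stage the subcomplex is embedded in
    a product of two finite trees, which grow along the way.

    All the trees are finite subtrees of one universal tree, in which every
    vertex carries infinitely many edges ([attach_fresh]); growing a tree at a
    vertex means using an edge whose index has not been used before, so nothing
    has to be modified or subdivided.  A point of the universal tree is the
    sequence of its heights along the edges, and an edge of index beyond [N]
    has height zero on everything built from the first [N] edges; this is what
    makes injectivity checks easy.

    The invariant ([adapted]) is that vertices of the complex go to pairs of
    vertices and edges of the complex go into the grid, the set of pairs with
    one coordinate at a vertex.  Gluing back an edge along a vertex is done with
    one new edge of the first tree ([expand_edge]).  Gluing back a disc along
    the arc complementary to its free edge is the main step ([expand_disc]).
    The arc is sent to an injective path in the grid joining two nodes, so it
    is a staircase: a finite sequence of runs on which one coordinate is a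
    constant vertex ([grid_path_staircase]).  A square can be attached to a
    staircase ([strip_exists]): on the last run, say with second coordinate
    constant, one takes the product of the run with a new edge of the second
    tree; what remains is to attach a square along the earlier runs followed by
    that new edge, and as the new edge prolongs the run just before, the number
    of runs has dropped by one.  The three other sides of the square land in the
    grid, so the invariant survives.

    To use this one needs the arc complementary to the free edge to be an arc,
    which is one-dimensional topology after a stereographic projection centred
    inside the free edge ([arc_complement]), and a parametrisation of the disc by
    the square that puts the arc at the bottom ([disc_to_square]), obtained by
    coning a parametrisation of the boundary.

    Finally, the complex that collapses is only known to be homeomorphic to a
    two-dimensional one, so one must know that it has no cell of dimension three
    or more ([cell_dim_le2]).  A ball of dimension at least three does not embed
    in the plane: otherwise, subtracting the values at opposite points of a
    2-sphere in the ball gives a map from a square to the punctured plane which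
    is odd on the boundary.  It has a continuous complex square root, and the
    quotient of the values of this root at opposite boundary points is imaginary
    and nonzero; yet its imaginary part changes sign between a boundary point and
    the opposite one ([no_odd_boundary]). *)

Set Implicit Arguments.
Unset Strict Implicit.
Unset Printing Implicit Defensive.
Import Order.TTheory GRing.Theory Num.Theory.
Import numFieldNormedType.Exports.

Local Open Scope classical_set_scope.
Local Open Scope ring_scope.

(** * The universal tree *)

(** The [i]-th edge of the universal tree joins vertex [i.+1] to the earlier vertex
    [attach i].  Any function with [attach i <= i] and infinite fibres would do. *)
Definition attach (i : nat) : nat := logn 2 i.+1.

Lemma attach_le i : (attach i <= i)%N.
Proof. by rewrite -ltnS /attach ltn_logl. Qed.

Lemma attach_fresh k N : exists2 i, (N <= i)%N & attach i = k.
Proof.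
have e_gt0 : (0 < 2 ^ k * (N.*2).+1)%N by rewrite muln_gt0 expn_gt0.
exists (2 ^ k * (N.*2).+1).-1.
  rewrite -ltnS prednK // (@leq_trans (N.*2).+1) ?leq_pmull ?expn_gt0 //.
  by rewrite ltnS -addnn leq_addr.
rewrite /attach prednK // lognM ?expn_gt0 // pfactorK // [X in (_ + X)%N]lognE /=.
by rewrite dvdn2 /= odd_double /= addn0.
Qed.

Section UniversalTree.
Variable R : realType.
Implicit Types (y : nat -> R) (t : R).

(** The first argument is fuel; [vert i] below is the indicator function of the
    edges on the way from the root, vertex [0], to vertex [i]. *)
Fixpoint vert_rec (n i : nat) : nat -> R :=
  match n, i with
  | n'.+1, i'.+1 => fun j => vert_rec n' (attach i') j + (j == i')%:R
  | _, _ => fun=> 0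
  end.

Definition vert (i : nat) : nat -> R := vert_rec i i.

Definition edge (i : nat) t : nat -> R :=
  fun j => vert (attach i) j + t * (j == i)%:R.

Lemma vert_recE n i : (i <= n)%N -> vert_rec n i = vert i.
Proof.
rewrite /vert; elim/ltn_ind: n i => n IH [|i]; first by case: n {IH}.
case: n IH => // n IH; rewrite ltnS => lin /=.
apply/funext => j; congr (_ + _).
rewrite IH ?(leq_trans (attach_le i)) //.
by rewrite [in RHS]IH ?ltnS ?attach_le.
Qed.

Lemma vert0 : vert 0 = fun=> 0. Proof. by []. Qed.

Lemma edge0 i : edge i 0 = vert (attach i).
Proof. by apply/funext => j; rewrite /edge mul0r addr0. Qed.

Lemma edge1 i : edge i 1 = vert i.+1.
Proof.
apply/funext => j; rewrite /edge mul1r {2}/vert /=.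
by rewrite vert_recE // attach_le.
Qed.

Lemma vert_ge i j : (i <= j)%N -> vert i j = 0.
Proof.
elim/ltn_ind: i j => -[|i] IH j; first by rewrite vert0.
move=> lij; rewrite -edge1 /edge IH ?ltnS ?attach_le //.
  by rewrite gtn_eqF // mulr0 addr0.
exact: leq_trans (attach_le i) (ltnW lij).
Qed.

Lemma edge_gt i t j : (i < j)%N -> edge i t j = 0.
Proof.
move=> lij; rewrite /edge vert_ge ?(leq_trans (attach_le i) (ltnW lij)) //.
by rewrite gtn_eqF // mulr0 addr0.
Qed.

Lemma edgeE i t : edge i t i = t.
Proof. by rewrite /edge vert_ge ?attach_le // eqxx mulr1 add0r. Qed.

Lemma vertE i : vert i.+1 i = 1.
Proof. by rewrite -edge1 edgeE. Qed.

Lemma vert01 i j : vert i j * (1 - vert i j) = 0.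
Proof.
elim/ltn_ind: i => -[|i] IH; first by rewrite vert0 mul0r.
have [ltji|ltij|->] := ltngtP j i.
- rewrite -edge1 /edge (ltn_eqF ltji) mulr0 addr0 IH // ltnS; exact: attach_le.
- by rewrite vert_ge ?mul0r.
- by rewrite vertE subrr mulr0.
Qed.

(** The index of an edge is the position of the last nonzero height. *)
Lemma edge_inj i i' t t' : 0 < t -> 0 < t' -> edge i t = edge i' t' ->
  i = i' /\ t = t'.
Proof.
move=> t0 t'0 E; have [ltii'|lti'i|ii'] := ltngtP i i'.
- by have := congr1 (@^~ i') E; rewrite /= edgeE edge_gt // => /eqP; rewrite lt_eqF.
- by have := congr1 (@^~ i) E; rewrite /= edgeE edge_gt // => /eqP; rewrite gt_eqF.
- by rewrite ii' in E *; have := congr1 (@^~ i') E; rewrite /= !edgeE.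
Qed.

Lemma vert_inj : injective vert.
Proof.
move=> [|i] [|j] //; rewrite -?edge1 => E.
- have := congr1 (@^~ j) E; rewrite /= edgeE => /esym/eqP; rewrite vert0.
  by rewrite oner_eq0.
- have := congr1 (@^~ i) E; rewrite /= edgeE => /eqP; rewrite vert0.
  by rewrite oner_eq0.
- by have [->] := edge_inj ltr01 ltr01 E.
Qed.

Definition subtree (N : nat) : set (nat -> R) :=
  [set y | exists i t, [/\ (i < N)%N, 0 <= t <= 1 & y = edge i t]].

Definition is_vert y := exists k, y = vert k.

Lemma subtreeW N M y : (N <= M)%N -> subtree N y -> subtree M y.
Proof.
by move=> NM [i [t [iN t01 ->]]]; exists i, t; split=> //; exact: leq_trans NM.
Qed.

Lemma subtree_vert N k : (0 < N)%N -> (k <= N)%N -> subtree N (vert k).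
Proof.
case: k => [|k] N0 kN.
  by exists 0%N, 0; rewrite edge0 /attach logn1 lexx ler01; split.
by exists k, 1; rewrite edge1 lexx ler01; split.
Qed.

Lemma subtree_ge N y j : subtree N y -> (N <= j)%N -> y j = 0.
Proof. by move=> [i [t [iN _ ->]]] Nj; rewrite edge_gt // (leq_trans iN). Qed.

(** On the [i]-th edge every height other than the [i]-th is 0 or 1, so this sum
    is [t * (1 - t)] at height [t]: it measures how far a point is from being a
    vertex. *)
Definition off_vert N y := \sum_(j < N) y j * (1 - y j).

Lemma off_vert_vert N k : off_vert N (vert k) = 0.
Proof. by rewrite /off_vert big1 // => j _; rewrite vert01. Qed.

Lemma off_vert_edge N i t : (i < N)%N -> off_vert N (edge i t) = t * (1 - t).
Proof.
move=> iN; rewrite /off_vert (bigD1 (Ordinal iN)) //= edgeE big1 ?addr0 //.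
move=> j; rewrite -val_eqE /= => /negPf ji.
by rewrite /edge ji mulr0 addr0 vert01.
Qed.

Lemma off_vert_ge0 N y : subtree N y -> 0 <= off_vert N y.
Proof.
move=> [i [t [iN /andP[t0 t1] ->]]]; rewrite off_vert_edge //.
by rewrite mulr_ge0 // subr_ge0.
Qed.

Lemma off_vertP N y : subtree N y -> off_vert N y = 0 <-> is_vert y.
Proof.
move=> [i [t [iN t01 ->]]]; split; last by move=> [k ->]; rewrite off_vert_vert.
rewrite off_vert_edge // => /eqP; rewrite mulf_eq0 subr_eq0 => /orP[]/eqP => [->|<-].
  by rewrite edge0; exists (attach i).
by rewrite edge1; exists i.+1.
Qed.

End UniversalTree.

(** * Real-valued continuous functions *)

Section ContinuityToolbox.
Variables (R : realType) (T : topologicalType).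
Implicit Types f g : T -> R.

Lemma continuous_cst_fun (a : R) : continuous (fun _ : T => a).
Proof. by move=> x; exact: cvg_cst. Qed.

Lemma continuous_add f g : continuous f -> continuous g ->
  continuous (fun x => f x + g x).
Proof. by move=> cf cg x; apply: cvgD; [exact: cf | exact: cg]. Qed.

Lemma continuous_opp f : continuous f -> continuous (fun x => - f x).
Proof. by move=> cf x; apply: cvgN; exact: cf. Qed.

Lemma continuous_mul f g : continuous f -> continuous g ->
  continuous (fun x => f x * g x).
Proof. by move=> cf cg x; apply: cvgM; [exact: cf | exact: cg]. Qed.

Lemma continuous_minr f g : continuous f -> continuous g ->
  continuous (fun x => Num.min (f x) (g x)).
Proof. by move=> cf cg x; apply: (@continuous_min R T f g); [exact: cf | exact: cg]. Qed.

Lemma continuous_maxr f g : continuous f -> continuous g ->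
  continuous (fun x => Num.max (f x) (g x)).
Proof. by move=> cf cg x; apply: (@continuous_max R T f g); [exact: cf | exact: cg]. Qed.

Lemma continuous_abs f : continuous f -> continuous (fun x => `|f x|).
Proof. by move=> cf x; apply: cvg_norm; exact: cf. Qed.

Lemma continuous_comp1 (h : R -> R) f : continuous h -> continuous f ->
  continuous (fun x => h (f x)).
Proof. by move=> ch cf x; apply: (continuous_comp (cf x)); exact: ch. Qed.

Lemma continuous_comp2 (h : R * R -> R) f g :
  continuous h -> continuous f -> continuous g ->
  continuous (fun x => h (f x, g x)).
Proof.
move=> ch cf cg x.
exact: (cvg_comp _ _ (cvg_pair (cf x) (cg x)) (ch (f x, g x))).
Qed.

End ContinuityToolbox.

Lemma continuous_fst_fun (R : realType) : continuous (fun z : R * R => z.1).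
Proof. by move=> z; exact: cvg_fst. Qed.

Lemma continuous_snd_fun (R : realType) : continuous (fun z : R * R => z.2).
Proof. by move=> z; exact: cvg_snd. Qed.

Lemma continuous_id_fun (T : topologicalType) : continuous (fun z : T => z).
Proof. by move=> z; exact: cvg_id. Qed.

Ltac cont := repeat (first
  [ assumption
  | match goal with
    | |- continuous (fun z => z) => exact: continuous_id_fun
    | |- continuous (fun z => fst z) => exact: continuous_fst_fun
    | |- continuous (fun z => snd z) => exact: continuous_snd_fun
    | |- continuous fst => exact: continuous_fst_fun
    | |- continuous snd => exact: continuous_snd_fun
    | |- continuous id => exact: continuous_id_fun
    | |- continuous (fun _ => ?a) => exact: continuous_cst_fun
    | |- continuous (fun z => @?f z + @?g z) => apply: (@continuous_add _ _ f g)
    | |- continuous (fun z => - @?f z) => apply: (@continuous_opp _ _ f)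
    | |- continuous (fun z => @?f z * @?g z) => apply: (@continuous_mul _ _ f g)
    | |- continuous (fun z => Num.min (@?f z) (@?g z)) =>
        apply: (@continuous_minr _ _ f g)
    | |- continuous (fun z => Num.max (@?f z) (@?g z)) =>
        apply: (@continuous_maxr _ _ f g)
    | |- continuous (fun z => `|@?f z|) => apply: (@continuous_abs _ _ f)
    end ]).

(** * Folding a corner of the square *)

Section Strips.
Variable R : realType.

Local Notation pt := (bool -> nat -> R).

Definition subtree2 (N : nat) : set pt := [set x | forall d, subtree N (x d)].

(** The points of the product of two trees are indexed by [bool], which selects the
    factor; [grid] is the 1-skeleton of the product and [node] its 0-skeleton. *)
Definition grid : set pt := [set x | exists d, is_vert (x d)].

Definition node : set pt := [set x | forall d, is_vert (x d)].

Definition cwise_continuous (T : topologicalType) (f : T -> pt) :=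
  forall d j, continuous (fun z => f z d j).

Definition run (al : R -> pt) (d : bool) (a b : R) :=
  exists k, forall s, a <= s <= b -> al s d = vert R k.

(** On [0, c] the path has [n] runs, with the coordinate [d] constant on the last
    one and the two coordinates alternating.  Runs may be reduced to a point, so
    that asking for alternation is no restriction. *)
Fixpoint staircase (n : nat) (d : bool) (al : R -> pt) (c : R) : Prop :=
  if n is n'.+1 then
    exists c', [/\ 0 <= c' <= c, run al d c' c & staircase n' (~~ d) al c']
  else c = 0.

(** An injection of the unit square into itself that straightens the bottom and
    right sides into the bottom side.  In the coordinates [X = x + y - 1] and
    [t = min y (1 - x)] the square becomes the triangle [|X| + t <= 1]; the
    triangle is then opened into a rectangle by keeping [g = |X| + t], which
    becomes the maximum of the new [|X|] and [t]. *)
Definition fold_corner (z : R * R) : R * R :=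
  let X := z.1 + z.2 - 1 in
  let t := Num.min z.2 (1 - z.1) in
  let g := `|X| + t in
  ((Num.max (- g) (Num.min g (2 * X)) + 1) / 2, Num.min g (2 * t)).

Definition unit_square : set (R * R) :=
  [set z | 0 <= z.1 <= 1 /\ 0 <= z.2 <= 1].

Definition open_sides : set (R * R) :=
  [set z | [\/ z.1 = 0, z.1 = 1 | z.2 = 1]].

Lemma fold_corner_continuous1 : continuous (fun z => (fold_corner z).1).
Proof. by rewrite /fold_corner /=; cont. Qed.

Lemma fold_corner_continuous2 : continuous (fun z => (fold_corner z).2).
Proof. by rewrite /fold_corner /=; cont. Qed.

Ltac splitminmax :=
  repeat match goal with
  | |- context [Num.min ?a ?b] => case: (leP a b) => ?
  | |- context [Num.max ?a ?b] => case: (leP a b) => ?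
  end.

(** The four regions are cut out by the diagonal [x + y = 1] of the square and by
    the lines [|X| = t] of the triangle. *)
Lemma fold_cornerE x y : 0 <= x <= 1 -> 0 <= y <= 1 ->
  [\/ [/\ x + y <= 1, 1 <= x + 2 * y &
        fold_corner (x, y) = (x + y - 1 / 2, 1 - x)],
     x + 2 * y <= 1 /\ fold_corner (x, y) = (x / 2, 2 * y),
     [/\ 1 <= x + y, 2 * x + y <= 2 &
        fold_corner (x, y) = (x + y - 1 / 2, y)] |
     2 <= 2 * x + y /\ fold_corner (x, y) = ((1 + y) / 2, 2 * (1 - x))].
Proof.
move=> /andP[x0 x1] /andP[y0 y1]; rewrite /fold_corner /=.
have [xy|xy] := leP (x + y) 1.
  have -> : Num.min y (1 - x) = y by rewrite min_l //; lra.
  have -> : `|x + y - 1| = - (x + y - 1) by rewrite ler0_norm //; lra.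
  have -> : - (x + y - 1) + y = 1 - x by lra.
  have [h|h] := leP 1 (x + 2 * y).
    apply: Or41; split=> //.
    by congr (_, _); splitminmax; lra.
  apply: Or42; split; first by lra.
  by congr (_, _); splitminmax; lra.
have -> : Num.min y (1 - x) = 1 - x by rewrite min_r //; lra.
have -> : `|x + y - 1| = x + y - 1 by rewrite ger0_norm //; lra.
have -> : x + y - 1 + (1 - x) = y by lra.
have [h|h] := leP (2 * x + y) 2.
  apply: Or43; split=> //; first by lra.
  by congr (_, _); splitminmax; lra.
apply: Or44; split; first by lra.
by congr (_, _); splitminmax; lra.
Qed.

Lemma fold_corner_square z : unit_square z -> unit_square (fold_corner z).
Proof.
case: z => x y [/= xI yI].
by have [[? ? ->]|[? ->]|[? ? ->]|[? ->]] := fold_cornerE xI yI; split=> /=; lra.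
Qed.

Lemma fold_corner_inj z z' : unit_square z -> unit_square z' ->
  fold_corner z = fold_corner z' -> z = z'.
Proof.
case: z z' => [x y] [x' y'] [/= xI yI] [/= x'I y'I].
by have [[? ? ->]|[? ->]|[? ? ->]|[? ->]] := fold_cornerE xI yI;
  have [[? ? ->]|[? ->]|[? ? ->]|[? ->]] := fold_cornerE x'I y'I;
  move=> -[? ?]; congr (_, _); lra.
Qed.

Lemma fold_corner_bottom x : 0 <= x <= 1 -> fold_corner (x, 0) = (x / 2, 0).
Proof.
move=> xI; have yI : 0 <= (0 : R) <= 1 by lra.
by have [[? ? ->]|[? ->]|[? ? ->]|[? ->]] := fold_cornerE xI yI; congr (_, _); lra.
Qed.

Lemma fold_corner_right y : 0 <= y <= 1 -> fold_corner (1, y) = ((1 + y) / 2, 0).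
Proof.
move=> yI; have xI : 0 <= (1 : R) <= 1 by lra.
by have [[? ? ->]|[? ->]|[? ? ->]|[? ->]] := fold_cornerE xI yI; congr (_, _); lra.
Qed.

Lemma fold_corner_height z : unit_square z -> (fold_corner z).2 = 0 ->
  z.2 = 0 \/ z.1 = 1.
Proof.
case: z => x y [xI yI]; rewrite /= in xI yI.
have [[? ? ->]|[? ->]|[? ? ->]|[? ->]] := fold_cornerE xI yI; rewrite /= => ?;
  by solve [left; lra | right; lra].
Qed.

Lemma fold_corner_sides z : unit_square z -> z.1 = 0 \/ z.2 = 1 ->
  open_sides (fold_corner z).
Proof.
case: z => x y [xI yI]; rewrite /= in xI yI.
have [[? ? ->]|[? ->]|[? ? ->]|[? ->]] := fold_cornerE xI yI; rewrite /open_sides /= => -[] ?;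
  by solve [apply: Or31; lra | apply: Or32; lra | apply: Or33; lra].
Qed.

End Strips.

(** * Attaching a square to a staircase *)

Section StripLemma.
Variable R : realType.
Local Notation pt := (bool -> nat -> R).

Definition climb (x : pt) (d : bool) (w : nat) (t : R) : pt :=
  fun e j => x e j + t * ((e == d) && (j == w))%:R.

Lemma climb0 x d w : climb x d w 0 = x.
Proof. by apply/funext => e; apply/funext => j; rewrite /climb mul0r addr0. Qed.

Lemma climbE x d w t : climb x d w t d w = x d w + t.
Proof. by rewrite /climb !eqxx mulr1. Qed.

Lemma climb_other x d w t e : e != d -> climb x d w t e = x e.
Proof. by move=> /negPf ed; apply/funext => j; rewrite /climb ed mulr0 addr0. Qed.

Lemma climb_edge x d w t : x d = vert R (attach w) -> climb x d w t d = edge w t.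
Proof. by move=> xd; apply/funext => j; rewrite /climb xd eqxx. Qed.

Lemma climb_inj x x' d w t : climb x d w t = climb x' d w t -> x = x'.
Proof.
move=> E; apply/funext => e; apply/funext => j.
by have := congr1 (fun f : pt => f e j) E; rewrite /climb => /addIr.
Qed.

Lemma cwise_continuous_climb (T : topologicalType) (f : T -> pt) (h : T -> R) d w :
  cwise_continuous f -> continuous h ->
  cwise_continuous (fun z => climb (f z) d w (h z)).
Proof.
move=> cf ch e j; rewrite /climb; apply: continuous_add; first exact: cf.
by cont.
Qed.

Lemma staircase_scale n d (al be : R -> pt) (r c : R) : 0 < r ->
  (forall s, 0 <= s <= c / r -> be s = al (r * s)) ->
  staircase n d al c -> staircase n d be (c / r).
Proof.
move=> r0; elim: n d c => [|n IH] d c be_al /=; first by move=> ->; rewrite mul0r.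
move=> [c' [/andP[c'0 c'c] [k runk] stair]]; exists (c' / r).
have c'cr : c' / r <= c / r by rewrite ler_pM2r ?invr_gt0.
have c'r0 : 0 <= c' / r by rewrite divr_ge0 // ltW.
split; first by rewrite c'r0.
  exists k => s /andP[c's sc]; rewrite be_al ?runk ?(le_trans c'r0) //.
  by rewrite mulrC -ler_pdivrMr // c's -ler_pdivlMr.
apply: IH => // s /andP[s0 sc']; apply: be_al; rewrite s0 /=.
exact: le_trans c'cr.
Qed.

(** [F] is an embedded square in a product of two larger trees, with bottom side
    [al].  By [strip_off] it meets the old product in this side only: some height
    along a new edge is nonzero. *)
Record strip_extension (N : nat) (al : R -> pt) (N' : nat) (F : R * R -> pt) :
    Prop := StripExtension {
  strip_le : (N <= N')%N;
  strip_continuous : cwise_continuous F;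
  strip_subtree : forall z, unit_square z -> subtree2 N' (F z);
  strip_inj : forall z z', unit_square z -> unit_square z' -> F z = F z' -> z = z';
  strip_bottom : forall s, 0 <= s <= 1 -> F (s, 0) = al s;
  strip_off : forall z, unit_square z -> 0 < z.2 ->
    exists e j, (N <= j)%N /\ F z e j != 0;
  strip_sides : forall z, unit_square z -> open_sides z -> grid (F z)
}.

Lemma subtree2_ge N (x : pt) d j : subtree2 N x -> (N <= j)%N -> x d j = 0.
Proof. by move=> /(_ d); exact: subtree_ge. Qed.

Lemma subtree2W N M (x : pt) : (N <= M)%N -> subtree2 N x -> subtree2 M x.
Proof. by move=> NM xN d; exact: subtreeW (xN d). Qed.

Lemma climb_subtree N (x : pt) d w t : subtree2 N x -> (N <= w)%N ->
  x d = vert R (attach w) -> 0 <= t <= 1 -> subtree2 w.+1 (climb x d w t).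
Proof.
move=> xN Nw xd t01 e; have [->|ed] := eqVneq e d.
  by rewrite climb_edge //; exists w, t; split.
by rewrite climb_other //; apply: subtreeW (xN e); exact: leqW.
Qed.

(** A straight path is extended by the product of the path with one new edge. *)
Lemma strip_straight d N (al : R -> pt) k : cwise_continuous al ->
  (forall s, 0 <= s <= 1 -> subtree2 N (al s)) ->
  (forall s s', 0 <= s <= 1 -> 0 <= s' <= 1 -> al s = al s' -> s = s') ->
  node (al 0) -> node (al 1) ->
  (forall s, 0 <= s <= 1 -> al s d = vert R k) ->
  exists N' F, strip_extension N al N' F.
Proof.
move=> cal alN inj_al n0 n1 ald; have [w Nw wk] := attach_fresh k N.
exists w.+1, (fun z => climb (al z.1) d w z.2); split.
- exact: leqW.
- apply: cwise_continuous_climb; last by cont.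
  move=> e j; apply: (continuous_comp1 (cal e j)); cont.
- move=> z [z1 z2]; apply: (climb_subtree (alN _ z1)) => //.
  by rewrite ald ?wk.
- move=> [x y] [x' y'] [/= x01 y01] [/= x'01 y'01] E.
  have yy' : y = y'.
    have := congr1 (fun f : pt => f d w) E.
    by rewrite !climbE !(subtree2_ge _ (alN _ _)) // !add0r.
  rewrite yy' in E *; congr (_, _); exact/inj_al/(climb_inj E).
- by move=> s s01 /=; rewrite climb0.
- move=> [x y] [/= x01 y01] y0; exists d, w; split=> //.
  by rewrite climbE (subtree2_ge _ (alN _ _)) // add0r gt_eqF.
- move=> [x y] [/= x01 y01]; have ndd : ~~ d != d by case: (d).
  move=> [/= E|/= E|/= E].
  + by exists (~~ d); rewrite climb_other ?E.
  + by exists (~~ d); rewrite climb_other ?E.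
  + by exists d; rewrite climb_edge ?E ?edge1; [exists w.+1 | rewrite ald ?wk].
Qed.

(** Induction on the number of runs.  If the last run starts at [c], the part of
    the square over [c, 1] is the product of this run with a new edge [w].  The
    part over [0, c] is a square to be attached along its bottom and right sides,
    that is, after [fold_corner], along the path [al'] that follows [al] up to [c]
    and then climbs [w].  The climb keeps the other coordinate fixed, as the run
    before [c] does, so [al'] has one run less than [al]. *)
Lemma strip_exists n d N (al : R -> pt) : cwise_continuous al ->
  (forall s, 0 <= s <= 1 -> subtree2 N (al s)) ->
  (forall s s', 0 <= s <= 1 -> 0 <= s' <= 1 -> al s = al s' -> s = s') ->
  node (al 0) -> node (al 1) -> staircase n d al 1 ->
  exists N' F, strip_extension N al N' F.
Proof.
elim: n d N al => [|n IH] d N al cal alN inj_al n0 n1.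
  by move=> /= /eqP; rewrite oner_eq0.
move=> [c [/andP[c0 c1] [k runk]] stair].
have [c_eq0|cN0] := eqVneq c 0.
  by apply: (strip_straight (d := d) (k := k)) => //; rewrite c_eq0 in runk.
have {c0 cN0} c0 : 0 < c by rewrite lt_neqAle eq_sym cN0.
have cI : 0 <= c <= 1 by rewrite ltW.
case: n IH stair => [|n] IH; first by move=> /= E; rewrite E ltxx in c0.
move=> [c'' [/andP[c''0 c''c] [k' runk'] stair]].
have ndd : ~~ d != d by case: (d).
have [w Nw wk] := attach_fresh k N.
(* On the first half of [0, 1] this is [al] on [0, c], on the second half the
   climb along [w]; this is the parametrisation produced by [fold_corner]. *)
pose al' s := climb (al (Num.min (2 * c * s) c)) d w (Num.max 0 (2 * s - 1)).
have alc : al c d = vert R (attach w) by rewrite wk runk // lexx.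
have u01 s : 0 <= s -> 0 <= Num.min (2 * c * s) c <= 1.
  move=> s0; rewrite le_min (ltW c0) andbT ge_min c1 orbT andbT.
  by rewrite mulr_ge0 // mulr_ge0 // ltW.
have al'_lo s : s <= 1 / 2 -> al' s = al (2 * c * s).
  move=> s2; rewrite /al' max_l ?climb0; last by lra.
  by rewrite min_l //; nra.
have al'_hi s : 1 / 2 <= s -> al' s = climb (al c) d w (2 * s - 1).
  move=> s2; rewrite /al' max_r; last by lra.
  by rewrite min_r //; nra.
have [] := IH (~~ d) w.+1 al'.
- apply: cwise_continuous_climb; last by cont; exact: (fun=> cvg_id).
  by move=> e j; apply: (continuous_comp1 (cal e j)); cont.
- move=> s /andP[s0 s1]; have [s2|s2] := leP s (1 / 2).
    rewrite al'_lo //; apply: (@subtree2W N); first exact: leqW.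
    by apply: alN; apply/andP; split; nra.
  by rewrite al'_hi ?(ltW s2) //; apply: (climb_subtree (alN _ cI)) => //; lra.
- move=> s s' s01 s'01 E.
  have [/andP[s0 s1] /andP[s'0 s'1]] := (s01, s'01).
  have E1 : Num.max 0 (2 * s - 1) = Num.max 0 (2 * s' - 1).
    have := congr1 (fun f : pt => f d w) E.
    by rewrite /al' !climbE !(subtree2_ge _ (alN _ _)) ?u01 // !add0r.
  have := E; rewrite /al' E1 => /climb_inj/inj_al.
  rewrite !u01 // => /(_ isT isT) E2.
  have [h|h] := leP s (1 / 2); have [h'|h'] := leP s' (1 / 2).
  + rewrite !min_l in E2; [|nra..].
    by apply: (@mulfI _ (2 * c)); rewrite ?mulf_neq0 ?gt_eqF.
  + by rewrite max_l ?max_r in E1; lra.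
  + by rewrite max_r ?max_l in E1; lra.
  + by rewrite !max_r in E1; lra.
- by rewrite al'_lo ?mulr0 //; lra.
- rewrite al'_hi; last by lra.
  have -> : 2 * 1 - 1 = 1 :> R by lra.
  move=> e; have [->|ed] := eqVneq e d.
    by rewrite climb_edge // edge1; exists w.+1.
  rewrite climb_other //; exists k'.
  have -> : e = ~~ d by move: ed; case: (e); case: (d).
  by rewrite runk' // c''c lexx.
- exists (c'' / (2 * c)).
  have c2 : 0 < 2 * c by lra.
  split.
  + rewrite divr_ge0 ?(ltW c2) //= ler_pdivrMr //; lra.
  + exists k' => s /andP[s0 s1]; rewrite /al' climb_other // runk' //.
    rewrite ge_min lexx orbT andbT le_min c''c andbT.
    by rewrite mulrC -ler_pdivrMr.
  + apply: staircase_scale stair => // s /andP[s0].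
    rewrite ler_pdivlMr // => sc; apply: al'_lo; nra.
move=> N' [F' [wN' cF' F'N' inj_F' F'bot F'off F'sides]].
pose fold (z : R * R) := fold_corner (Num.min z.1 c / c, z.2).
(* The two parts agree over [c], where both are equal to the last term; adding
   and subtracting it makes the continuity of the pasted map evident. *)
pose F (z : R * R) : pt := fun e j =>
  F' (fold z) e j + climb (al (Num.max z.1 c)) d w z.2 e j
  - climb (al c) d w z.2 e j.
have Fhi z : unit_square z -> c <= z.1 -> F z = climb (al z.1) d w z.2.
  move=> [z1 z2] cz; rewrite /F; apply/funext => e; apply/funext => j.
  rewrite /fold min_r // divff ?gt_eqF // max_l // fold_corner_right // F'bot; last by lra.
  rewrite al'_hi; last by lra.
  have -> : 2 * ((1 + z.2) / 2) - 1 = z.2 by lra.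
  by rewrite addrAC subrr add0r.
have Flo z : unit_square z -> z.1 <= c -> F z = F' (fold_corner (z.1 / c, z.2)).
  move=> [z1 z2] cz; rewrite /F; apply/funext => e; apply/funext => j.
  by rewrite /fold min_l // max_r // addrK.
have usq z : unit_square z -> z.1 <= c -> unit_square (z.1 / c, z.2).
  move=> [/andP[z10 z11] z2] zc; split=> //=.
  by rewrite divr_ge0 ?(ltW c0) //= ler_pdivrMr // mul1r.
have bot0 x : 0 <= x <= c -> F' (fold_corner (x / c, 0)) = al x.
  move=> /andP[x0 xc]; rewrite fold_corner_bottom; last first.
    by rewrite divr_ge0 ?(ltW c0) //= ler_pdivrMr // mul1r.
  have E : x / c / 2 = x / (2 * c) by rewrite invfM mulrA mulrAC.
  have xc2 : x / (2 * c) <= 1 / 2 by rewrite ler_pdivrMr; lra.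
  have xc0 : 0 <= x / (2 * c) by rewrite divr_ge0 //; lra.
  rewrite E F'bot ?al'_lo //; last by lra.
  by rewrite mulrC mulfVK //; lra.
have off z : unit_square z -> 0 < z.2 -> exists e j, (N <= j)%N /\ F z e j != 0.
  move=> zs z20; have [z1 z2] := zs; have [zc|zc] := leP c z.1.
    exists d, w; split=> //.
    by rewrite Fhi // climbE (subtree2_ge _ (alN _ _)) // add0r gt_eqF.
  have [zs'] := usq _ zs (ltW zc).
  rewrite Flo //; last exact: ltW.
  have zf := fold_corner_square (usq _ zs (ltW zc)).
  have h0 : 0 < (fold_corner (z.1 / c, z.2)).2.
    rewrite lt_neqAle; have [_ /andP[-> _]] := zf; rewrite andbT eq_sym.
    apply/eqP => /(fold_corner_height (usq _ zs (ltW zc)))[/= E|/= E].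
      by rewrite E ltxx in z20.
    move: zc; rewrite -[X in X < _](@mulfVK _ c) ?gt_eqF // E mul1r ltxx //.
  have [e [j [wj F'0]]] := F'off _ zf h0.
  by exists e, j; split=> //; exact: leq_trans (ltnW wj).
exists N', F; split=> //.
- exact: leq_trans Nw (ltnW wN').
- move=> e j; rewrite /F; apply: continuous_add; first apply: continuous_add.
  + have -> : (fun z => F' (fold z) e j) =
        (fun z => (fun y => F' y e j) ((fold z).1, (fold z).2)).
      by apply/funext => z; rewrite -surjective_pairing.
    apply: (@continuous_comp2 _ _ (fun y => F' y e j) (fun z => (fold z).1)
      (fun z => (fold z).2)); first exact: (cF' e j).
      apply: (@continuous_comp2 _ _ (fun z => (fold_corner z).1)); last by cont.
        exact: fold_corner_continuous1.
      by cont.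
    apply: (@continuous_comp2 _ _ (fun z => (fold_corner z).2)); last by cont.
      exact: fold_corner_continuous2.
    by cont.
  + apply: cwise_continuous_climb; last by cont.
    by move=> e' j'; apply: (continuous_comp1 (cal e' j')); cont.
  + apply: continuous_opp; apply: (@cwise_continuous_climb _ (fun=> al c)).
      by move=> e' j'; cont.
    by cont.
- move=> z zs; have [zc|zc] := leP c z.1.
    rewrite Fhi //; apply: (@subtree2W w.+1) => //.
    have [z1 z2] := zs; apply: (climb_subtree (alN _ z1)) => //.
    by rewrite runk ?wk // zc; case/andP: z1.
  rewrite Flo ?(ltW zc) //; apply: F'N'; apply: fold_corner_square.
  exact: usq (ltW zc).
- have cross z z' : unit_square z -> unit_square z' -> z.1 < c -> c <= z'.1 ->
      F z <> F z'.
    move=> zs zs' zc z'c E; have [z1 z2] := zs; have [z'1 z'2] := zs'.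
    have [z'20|z'20] := eqVneq z'.2 0.
      have [z20|z20] := eqVneq z.2 0.
        move: E; rewrite (Fhi z') // z'20 climb0 (Flo z) ?(ltW zc) // z20 bot0.
          by move=> /inj_al E; move: zc; rewrite E // ltNge z'c.
        by case/andP: z1 => -> _; rewrite ltW.
      have z2p : 0 < z.2 by rewrite lt_neqAle eq_sym z20; case/andP: z2.
      have [e [j [Nj]]] := off _ zs z2p.
      by rewrite E (Fhi z') // z'20 climb0 (subtree2_ge _ (alN _ _)) // eqxx.
    have zf := fold_corner_square (usq _ zs (ltW zc)).
    move: (E); rewrite (Flo z) ?(ltW zc) //.
    have [h0|h0] := eqVneq (fold_corner (z.1 / c, z.2)).2 0.
      case: (fold_corner_height (usq _ zs (ltW zc)) h0) => /= E1.
        rewrite E1 bot0; last by case/andP: z1 => -> _; rewrite ltW.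
        move=> E2; have := congr1 (fun f : pt => f d w) E2.
        rewrite (Fhi z') // climbE !(subtree2_ge _ (alN _ _)) // add0r => /eqP.
        by rewrite eq_sym (negPf z'20).
      by move: zc; rewrite -[X in X < _](@mulfVK _ c) ?gt_eqF // E1 mul1r ltxx.
    have hp : 0 < (fold_corner (z.1 / c, z.2)).2.
      by rewrite lt_neqAle eq_sym h0; case: zf => _ /andP[].
    have [e [j [wj]]] := F'off _ zf hp; move=> F'0 E2; move: F'0.
    rewrite E2 (Fhi z') // (@subtree2_ge w.+1) ?eqxx //.
    apply: (climb_subtree (alN _ z'1)) => //.
    by rewrite runk ?wk // z'c; case/andP: z'1.
  move=> z z' zs zs' E.
  have [zc|zc] := leP c z.1; have [z'c|z'c] := leP c z'.1.
  + have [z1 z2] := zs; have [z'1 z'2] := zs'.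
    move: E; rewrite !Fhi // => E.
    have yy' : z.2 = z'.2.
      have := congr1 (fun f : pt => f d w) E.
      by rewrite !climbE !(subtree2_ge _ (alN _ _)) // !add0r.
    rewrite yy' in E; have xx' := inj_al _ _ z1 z'1 (climb_inj E).
    by rewrite [z]surjective_pairing [z']surjective_pairing xx' yy'.
  + by have := cross _ _ zs' zs z'c zc; rewrite E.
  + by have := cross _ _ zs zs' zc z'c; rewrite E.
  + move: E; rewrite !Flo ?ltW // => /inj_F' E.
    have {}E := E (fold_corner_square (usq _ zs (ltW zc)))
                  (fold_corner_square (usq _ zs' (ltW z'c))).
    have [] := fold_corner_inj (usq _ zs (ltW zc)) (usq _ zs' (ltW z'c)) E.
    move=> /(mulIf _) E1 E2.
    rewrite [z]surjective_pairing [z']surjective_pairing E1 ?E2 //.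
    by rewrite invr_eq0 gt_eqF.
- move=> s s01; have ss : unit_square (s, 0 : R) by split=> //=; rewrite lexx ler01.
  have [sc|sc] := leP c s; first by rewrite Fhi //= climb0.
  rewrite Flo ?(ltW sc) //= bot0 // (ltW sc) andbT.
  by case/andP: s01.
- move=> z zs sides; have [z1 z2] := zs; have [zc|zc] := leP c z.1.
    rewrite Fhi //; case: sides => E.
    + by move: zc; rewrite E leNgt c0.
    + by exists (~~ d); rewrite climb_other // E.
    + exists d; rewrite climb_edge ?E ?edge1; first by exists w.+1.
      by rewrite runk ?wk // zc; case/andP: z1.
  rewrite Flo ?(ltW zc) //; apply: F'sides.
    exact/fold_corner_square/usq/ltW.
  apply: fold_corner_sides; first exact/usq/ltW.
  case: sides => E /=; [left|exfalso|by right].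
    by rewrite E mul0r.
  by move: zc; rewrite E ltNge c1.
Qed.

End StripLemma.

(** * Paths in the grid *)

Section GridPaths.
Variable R : realType.
Local Notation pt := (bool -> nat -> R).

Lemma intermediate_value (f : R -> R) (a b v : R) : continuous f ->
  f a <= v <= f b -> exists2 c, Num.min a b <= c <= Num.max a b & f c = v.
Proof.
move=> cf /andP[fav fbv].
have [ab|/ltW ba] := leP a b.
  have [||c cab <-] := @IVT R f a b v ab.
  - exact: continuous_subspaceT.
  - by rewrite ge_min fav le_max fbv orbT.
  - by exists c => //; rewrite in_itv /= in cab.
have [||c cab <-] := @IVT R f b a v ba.
- exact: continuous_subspaceT.
- by rewrite ge_min fav le_max fbv orbT.
- by exists c => //; rewrite in_itv /= in cab.
Qed.

Lemma continuous_sum (T : topologicalType) n (f : nat -> T -> R) :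
  (forall i, continuous (f i)) -> continuous (fun s => \sum_(i < n) f i s).
Proof.
move=> cf; elim: n => [|n IH].
  have -> : (fun s => \sum_(i < 0) f i s) = (fun=> 0).
    by apply/funext => s; rewrite big_ord0.
  exact: continuous_cst_fun.
have -> : (fun s => \sum_(i < n.+1) f i s) =
    (fun s => \sum_(i < n) f i s + f n s).
  by apply/funext => s; rewrite big_ord_recr.
exact: continuous_add.
Qed.

(** If two consecutive runs have the same constant coordinate, a run reduced to a
    point is inserted between them. *)
Lemma staircase_rcons n d e (al : R -> pt) c c' : 0 <= c' <= c -> node (al c') ->
  run al d c' c -> staircase n e al c' -> exists m, staircase m d al c.
Proof.
move=> c'c nodec' rund stair.
have [ed|ed] := eqVneq e (~~ d).
  by exists n.+1, c'; split=> //; rewrite -ed.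
have {ed} ed : e = d by move: ed; case: (e); case: (d).
exists n.+2, c'; split=> //; exists c'; split.
- by case/andP: c'c => ->; rewrite lexx.
- have [k alk] := nodec' (~~ d).
  by exists k => s; rewrite -eq_le => /eqP <-.
- by rewrite negbK -ed.
Qed.

Variables (N : nat) (al : R -> pt).
Hypothesis al_cont : cwise_continuous al.
Hypothesis al_sub : forall s, 0 <= s <= 1 -> subtree2 N (al s).
Hypothesis al_inj :
  forall s s', 0 <= s <= 1 -> 0 <= s' <= 1 -> al s = al s' -> s = s'.
Hypothesis al_grid : forall s, 0 <= s <= 1 -> grid (al s).

Let rho d s := off_vert N (al s d).

Lemma off_vert_continuous d : continuous (rho d).
Proof.
apply: (@continuous_sum _ N (fun i s => al s d i * (1 - al s d i))) => i.
by have cal := @al_cont d i; cont.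
Qed.

(** The heights of a vertex are 0 or 1, so by connectedness they cannot vary. *)
Lemma vert_run d a b : 0 <= a -> b <= 1 ->
  (forall s, a <= s <= b -> is_vert (al s d)) -> run al d a b.
Proof.
move=> a0 b1 alv; have [ab|ba] := leP a b; last first.
  by exists 0%N => s /andP[as_ sb]; move: ba; rewrite ltNge (le_trans as_ sb).
have [k alk] := alv a (introT andP (conj (lexx a) ab)).
exists k => s asb; rewrite -alk; apply/funext => j.
have val01 t : a <= t <= b -> al t d j = 0 \/ al t d j = 1.
  move=> /alv[k' ->]; have /eqP := vert01 R k' j.
  by rewrite mulf_eq0 subr_eq0 => /orP[]/eqP => [->|<-]; [left|right].
have halfN t : a <= t <= b -> al t d j <> 1 / 2.
  by move=> /val01[]-> => E; lra.
have [/andP[as_ sb] aab] := (asb, introT andP (conj (lexx a) ab)).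
have [Es|Es] := val01 s asb; have [Ea|Ea] := val01 a aab; rewrite Es Ea //.
- have [|c] := @intermediate_value (fun t => al t d j) s a (1 / 2) (@al_cont d j).
    by rewrite Es Ea; lra.
  rewrite min_r ?max_l // => /andP[ac cs] E; case: (halfN c) => //.
  by rewrite ac (le_trans cs).
- have [|c] := @intermediate_value (fun t => al t d j) a s (1 / 2) (@al_cont d j).
    by rewrite Es Ea; lra.
  rewrite min_l ?max_r // => /andP[ac cs] E; case: (halfN c) => //.
  by rewrite ac (le_trans cs).
Qed.

(** Away from nodes exactly one of the two coordinates is a vertex, that is,
    exactly one of the functions [rho d], [rho (~~ d)] vanishes; by the intermediate
    value theorem applied to their difference it is always the same one. *)
Lemma grid_run a b : 0 <= a -> a < b -> b <= 1 -> node (al a) -> node (al b) ->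
  (forall s, a < s < b -> ~ node (al s)) -> exists d, run al d a b.
Proof.
move=> a0 ab b1 nodea nodeb nonode; pose m := (a + b) / 2.
have amb : a < m < b by rewrite /m; lra.
have in01 s : a < s < b -> 0 <= s <= 1 by lra.
have [d vm] := al_grid (in01 _ amb); exists d; apply: vert_run => // s.
move=> /andP[]; rewrite le_eqVlt => /orP[/eqP <- _|a_s]; first exact: nodea.
rewrite le_eqVlt => /orP[/eqP ->|sb]; first exact: nodeb.
have asb : a < s < b by rewrite a_s.
have [e vs] := al_grid (in01 _ asb).
have [<- //|ed] := eqVneq e d.
have {ed} ed : e = ~~ d by move: ed; case: (e); case: (d).
have rho0 t f : 0 <= t <= 1 -> rho f t = 0 <-> is_vert (al t f).
  by move=> t01; apply: off_vertP; exact: al_sub.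
have rho_ge t f : 0 <= t <= 1 -> 0 <= rho f t.
  by move=> t01; apply: off_vert_ge0; exact: al_sub.
have := @intermediate_value (fun t => rho d t - rho e t) m s 0.
have cd := @off_vert_continuous d; have ce := @off_vert_continuous e.
case.
- by cont.
- have -> : rho d m = 0 by apply/rho0 => //; exact: in01.
  have -> : rho e s = 0 by apply/rho0 => //; exact: in01.
  by rewrite sub0r subr0 oppr_le0 !rho_ge ?in01.
move=> c cI rhoc; have acb : a < c < b.
  case/andP: cI; rewrite ge_min le_max => /orP[] h1 /orP[] h2; lra.
have c01 := in01 _ acb.
have [f vf] := al_grid c01.
have := (rho0 c f c01).2 vf => rf.
have re_d : rho e c = rho d c by lra.
have r0 g : rho g c = 0.
  have [->|->] : g = d \/ g = e by rewrite ed; case: (g); case: (d); auto.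
    move: rf; have [->|->] // : f = d \/ f = e.
      by rewrite ed; case: (f); case: (d); auto.
    by rewrite re_d.
  move: rf; have [->|->] // : f = d \/ f = e.
    by rewrite ed; case: (f); case: (d); auto.
  by rewrite re_d.
by case: (nonode c acb) => g; apply/rho0.
Qed.

Lemma subtree_vert_le k : subtree N (vert R k) -> (k <= N)%N.
Proof.
case: k => // k kN; rewrite ltnNge; apply/negP => Nk.
by have := vertE R k; rewrite (subtree_ge kN Nk) => /eqP; rewrite eq_sym oner_eq0.
Qed.

(** There are finitely many nodes in the product of two finite trees and the path
    is injective, so it visits nodes finitely many times. *)
Lemma node_times : exists l : seq R,
  forall s, 0 <= s <= 1 -> node (al s) -> s \in l.
Proof.
pose time k1 k2 := xget (0 : R) [set s | [/\ 0 <= s <= 1,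
  al s true = vert R k1 & al s false = vert R k2]].
exists [seq time k1 k2 | k1 <- iota 0 N.+1, k2 <- iota 0 N.+1] => s s01 ns.
have [k1 E1] := ns true; have [k2 E2] := ns false.
have kN d k : al s d = vert R k -> k \in iota 0 N.+1.
  move=> E; rewrite mem_iota add0n ltnS subtree_vert_le // -E.
  exact: al_sub.
have -> : s = time k1 k2.
  have [|t01 t1 t2] := @xgetPex _ 0 [set s | [/\ 0 <= s <= 1,
    al s true = vert R k1 & al s false = vert R k2]]; first by exists s; split.
  apply: al_inj => //; apply/funext => -[]; first by rewrite E1.
  by rewrite E2.
by apply: allpairs_f; [exact: kN E1 | exact: kN E2].
Qed.

Lemma seq_max (l : seq R) x : x \in l ->
  exists2 m, m \in l & forall y, y \in l -> y <= m.
Proof.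
elim: l x => // a l IH _ _; case: l IH => [|b l] IH.
  by exists a; rewrite ?mem_head // => y; rewrite inE => /eqP ->.
have [m ml mmax] := IH b (mem_head b l).
have [am|ma] := leP a m.
  exists m; first by rewrite in_cons ml orbT.
  by move=> y; rewrite in_cons => /orP[/eqP->|/mmax].
exists a; first exact: mem_head.
move=> y; rewrite in_cons => /orP[/eqP-> //|/mmax ym]; exact: le_trans ym (ltW ma).
Qed.

(** The runs are the pieces between consecutive visits to nodes. *)
Lemma grid_path_staircase : node (al 0) -> node (al 1) ->
  exists n d, staircase n d al 1.
Proof.
move=> n0 n1; have [l0 l0P] := node_times.
suff H m : forall c (l : seq R), (size l <= m)%N -> 0 <= c <= 1 -> node (al c) ->
    (forall s, 0 <= s < c -> node (al s) -> s \in l) ->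
    exists n d, staircase n d al c.
  apply: (H (size l0) 1 l0) => // [|s /andP[s0 s1]]; first by rewrite ler01 lexx.
  by apply: l0P; rewrite s0 ltW.
elim: m => [|m IH] c l; rewrite ?leqn0 ?size_eq0.
  move=> /eqP -> /andP[c0 c1] nc lP'.
  have [c_eq0|cN0] := eqVneq c 0; first by exists 0%N, true.
  by have := lP' 0; rewrite lexx lt_neqAle eq_sym cN0 c0 => /(_ isT n0).
move=> lm /andP[c0 c1] nc lP'.
have [c_eq0|cN0] := eqVneq c 0; first by exists 0%N, true.
have {c0 cN0} c0 : 0 < c by rewrite lt_neqAle eq_sym cN0.
pose l' := [seq t <- l | (0 <= t < c) && `[< node (al t) >]].
have [|c' c'l' c'max] := @seq_max l' 0.
  rewrite mem_filter lexx c0 lP' ?lexx ?c0 // andbT /=; exact/asboolP.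
have : c' \in l by move: c'l'; rewrite mem_filter => /andP[].
move: c'l'; rewrite mem_filter => /andP[/andP[/andP[c'0 c'c] /asboolP nc'] _] c'l.
have [d rund] : exists d, run al d c' c.
  apply: grid_run => // s /andP[c's sc] ns.
  have s0c : 0 <= s < c by rewrite sc (le_trans c'0 (ltW c's)).
  have /c'max : s \in l'.
    by rewrite mem_filter s0c lP' // andbT /=; exact/asboolP.
  by rewrite leNgt c's.
have [||||n [e stair]] := IH c' [seq t <- l | t < c'].
- rewrite -ltnS; apply: leq_trans lm; rewrite size_filter ltn_neqAle count_size.
  by rewrite andbT -all_count; apply/allPn; exists c'; rewrite ?ltxx.
- by rewrite c'0 (le_trans (ltW c'c)).
- by [].
- move=> s /andP[s0 sc'] ns; rewrite mem_filter sc' lP' // s0.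
  exact: lt_trans sc' c'c.
have [|k] := staircase_rcons (c := c) _ nc' rund stair; last by exists k, d.
by rewrite c'0 ltW.
Qed.

End GridPaths.

(** * Maps out of compact sets *)

Section Topology.

Lemma comp_within_continuous (T U V : topologicalType) (A : set T) (B : set U)
    (f : T -> U) (g : U -> V) :
  {within A, continuous f} -> {within B, continuous g} ->
  (forall x, A x -> B (f x)) -> {within A, continuous (fun x => g (f x))}.
Proof.
move=> /subspace_continuousP cf /subspace_continuousP cg AB.
apply/subspace_continuousP => x Ax W gW.
have := cg _ (AB _ Ax) W gW; move=> /(cf _ Ax).
rewrite /nbhs /= /within /=; apply: filterS => y.
by move=> h Ay; apply: h => //; exact: AB.
Qed.

(** A continuous map from a compact set to a Hausdorff space is closed, hence a
    quotient map onto its image.  Most maps below are defined on pieces through a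
    parametrisation [chi], and are continuous for this reason. *)
Lemma factor_continuous (T X U : topologicalType) (A : set T) (chi : T -> X)
    (g : T -> U) (h : X -> U) : hausdorff_space X -> compact A ->
  {within A, continuous chi} -> {within A, continuous g} ->
  (forall a, A a -> h (chi a) = g a) -> {within chi @` A, continuous h}.
Proof.
move=> hX cA cchi cg hg; apply/continuous_closedP => C cC.
apply/closed_subspaceP; exists (chi @` (A `&` g @^-1` C)).
  have [V cV VA] : exists2 V, closed V & V `&` A = g @^-1` C `&` A.
    by apply/closed_subspaceP; move/continuous_closedP : cg; exact.
  rewrite setIC -VA setIC; apply: compact_closed => //.
  apply: continuous_compact; last exact: compact_closedI.
  by apply: continuous_subspaceW cchi => x [].
apply/seteqP; split=> x [].
  move=> [a [Aa Ca] <-] _; split; last by exists a.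
  by move: Ca; rewrite /preimage /= -(hg _ Aa).
by move=> hx [a Aa ax]; split; [exists a => //; split=> //=; rewrite -hg // ax | exists a].
Qed.

Lemma embedding_inverse (T X : topologicalType) (A : set T) (chi : T -> X) (a0 : T) :
  hausdorff_space X -> compact A -> {within A, continuous chi} ->
  (forall a b, A a -> A b -> chi a = chi b -> a = b) ->
  exists hinv : X -> T, {within chi @` A, continuous hinv} /\
    forall a, A a -> hinv (chi a) = a.
Proof.
move=> hX cA cchi chi_inj.
have [hinv hP] : {hinv : X -> T & forall x a, A a -> x = chi a -> hinv x = a}.
  apply: (@choice _ _ (fun x b => forall a, A a -> x = chi a -> b = a)) => x.
  have [[a Aa xa]|no] := pselect (exists2 a, A a & x = chi a).
    by exists a => b Ab; rewrite xa; exact: chi_inj.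
  by exists a0 => a Aa xa; case: no; exists a.
have hE a : A a -> hinv (chi a) = a by move=> Aa; exact: hP.
exists hinv; split=> //; apply: (factor_continuous (g := id)) => //.
by apply: continuous_subspaceT; exact: continuous_id_fun.
Qed.

Lemma continuous_rV (R : realType) (T : topologicalType) n (f : T -> 'rV[R]_n) :
  (forall i, continuous (fun x => f x ord0 i)) -> continuous f.
Proof.
move=> cf x W [P PW sPW].
have near_P : \forall y \near x, forall i, P ord0 i (f y ord0 i).
  by apply: filter_forall => i; exact: (cf i x _ (PW ord0 i)).
apply: filterS near_P => y Py; apply: sPW => i j.
by rewrite (ord1 i); exact: Py.
Qed.

Lemma continuous_sqnorm (R : realType) n :
  continuous (fun x : 'rV[R]_n => sqnorm x).
Proof.
case: n => [|n].
  have -> : (fun x : 'rV[R]_0 => sqnorm x) = fun=> 0.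
    by apply/funext => x; rewrite /sqnorm big_ord0.
  exact: continuous_cst_fun.
have -> : (fun x : 'rV[R]_n.+1 => sqnorm x) =
    (fun x => \sum_(i < n.+1) (x ord0 (inord i) * x ord0 (inord i))).
  by apply/funext => x; apply: eq_bigr => i _; rewrite inord_val expr2.
apply: (@continuous_sum R _ n.+1 (fun i (x : 'rV[R]_n.+1) =>
   x ord0 (inord i) * x ord0 (inord i))) => i.
have c := @coord_continuous R 1 n.+1 ord0 (inord i).
by apply: continuous_mul.
Qed.

Lemma sqnorm_coord (R : realType) n (x : 'rV[R]_n) i : x ord0 i ^+ 2 <= sqnorm x.
Proof.
rewrite /sqnorm (bigD1 i) //= lerDl; apply: sumr_ge0 => j _; exact: sqr_ge0.
Qed.

Lemma compact_in_disc (R : realType) n (A : set 'rV[R]_n) :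
  closed A -> A `<=` closed_disc R n -> compact A.
Proof.
move=> cA Adisc; apply: bounded_closed_compact => //.
exists 1; split; first exact: num_real.
move=> M M1 x /Adisc x1; rewrite /= /Num.norm /= mx_normrE.
apply: bigmax_le; first exact: le_trans (ltW M1).
move=> [i j] _ /=; apply: le_trans (ltW M1); rewrite (ord1 i).
rewrite -(@ler_pXn2r _ 2) ?nnegrE // ?normr_ge0 // expr1n.
rewrite real_normK ?num_real //; exact: le_trans (sqnorm_coord _ _) x1.
Qed.

Lemma compact_closed_disc (R : realType) n : compact (closed_disc R n).
Proof.
apply: compact_in_disc => //.
apply: (@preimage_closed _ _ (fun x : 'rV[R]_n => sqnorm x) [set t | t <= 1]).
  by move=> x _; exact: continuous_sqnorm.
exact: closed_le.
Qed.

Lemma compact_unit_sphere (R : realType) n : compact (unit_sphere R n).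
Proof.
apply: compact_in_disc; last by move=> x; rewrite /unit_sphere /closed_disc /= => ->.
apply: (@preimage_closed _ _ (fun x : 'rV[R]_n => sqnorm x) [set t | t = 1]).
  by move=> x _; exact: continuous_sqnorm.
exact: closed_eq.
Qed.

End Topology.

(** * From the disc to the square *)

Section DiscToSquare.
Variable R : realType.

Lemma segmentP (a b x : R) : `[a, b]%classic x <-> a <= x <= b.
Proof. by rewrite /= in_itv. Qed.

Lemma sqnormZ n (r : R) (x : 'rV[R]_n) : sqnorm (r *: x) = r ^+ 2 * sqnorm x.
Proof.
by rewrite /sqnorm mulr_sumr; apply: eq_bigr => i _; rewrite mxE exprMn.
Qed.

Lemma sqnorm_ge0 n (x : 'rV[R]_n) : 0 <= sqnorm x.
Proof. by apply: sumr_ge0 => i _; exact: sqr_ge0. Qed.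

Lemma sqnorm_eq0 n (x : 'rV[R]_n) : sqnorm x = 0 -> x = 0.
Proof.
move=> x0; apply/rowP => i; rewrite mxE; apply/eqP; rewrite -sqrf_eq0 eq_le sqr_ge0.
by rewrite andbT -x0 sqnorm_coord.
Qed.

(** The path that runs along the left, top and right sides of the unit square,
    for [u] between [-1] and [1]. *)
Definition side (u : R) : R * R :=
  (Num.max 0 (Num.min 1 ((3 * u + 1) / 2)), Num.min 1 (3 * (1 - `|u|) / 2)).

Lemma sideE u : -1 <= u <= 1 ->
  [\/ -1 <= u <= - 1 / 3 /\ side u = (0, 3 * (1 + u) / 2),
      - 1 / 3 <= u <= 1 / 3 /\ side u = ((3 * u + 1) / 2, 1) |
      1 / 3 <= u <= 1 /\ side u = (1, 3 * (1 - u) / 2)].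
Proof.
move=> /andP[u0 u1]; rewrite /side.
have [h|h] := leP u (- 1 / 3).
  apply: Or31; split; first by rewrite u0.
  rewrite ler0_norm; last by lra.
  by congr (_, _); [rewrite max_l // ge_min | rewrite min_r]; lra.
have [h'|h'] := leP u (1 / 3).
  apply: Or32; split; first by rewrite ltW.
  congr (_, _); first by rewrite min_r ?max_r; lra.
  by rewrite min_l //; case: (ger0P u) => ?; lra.
apply: Or33; split; first by rewrite ltW.
rewrite ger0_norm; last by lra.
by congr (_, _); [rewrite min_l ?max_r | rewrite min_r]; lra.
Qed.

Lemma side_inj u v : -1 <= u <= 1 -> -1 <= v <= 1 -> side u = side v -> u = v.
Proof.
move=> uI vI.
by have [[/andP[? ?] ->]|[/andP[? ?] ->]|[/andP[? ?] ->]] := sideE uI;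
  have [[/andP[? ?] ->]|[/andP[? ?] ->]|[/andP[? ?] ->]] := sideE vI;
  move=> E; have /= := congr1 fst E; have /= := congr1 snd E; lra.
Qed.

Lemma side_square u : -1 <= u <= 1 -> unit_square (side u) /\ open_sides (side u).
Proof.
move=> uI; rewrite /unit_square /open_sides.
have [[/andP[? ?] ->]|[/andP[? ?] ->]|[/andP[? ?] ->]] := sideE uI => /=.
- by split; [lra | apply: Or31].
- by split; [lra | apply: Or33].
- by split; [lra | apply: Or32].
Qed.

Lemma side_bottom u s : -1 <= u <= 1 -> side u = (s, 0) ->
  (u = -1 /\ s = 0) \/ (u = 1 /\ s = 1).
Proof.
move=> uI.
have [[/andP[? ?] ->]|[/andP[? ?] ->]|[/andP[? ?] ->]] := sideE uI => -[? ?].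
- by left; lra.
- by exfalso; lra.
- by right; lra.
Qed.

Lemma side_ends : side (-1) = (0, 0) /\ side 1 = (1, 0).
Proof.
have I1 : -1 <= (-1 : R) <= 1 by lra.
have I2 : -1 <= (1 : R) <= 1 by lra.
split.
  by have [[/andP[? ?] ->]|[/andP[? ?] ->]|[/andP[? ?] ->]] := sideE I1;
    congr (_, _); lra.
by have [[/andP[? ?] ->]|[/andP[? ?] ->]|[/andP[? ?] ->]] := sideE I2;
  congr (_, _); lra.
Qed.

Record loop_decomposition (be ph : R -> 'rV[R]_2) : Prop := LoopDecomposition {
  loop_be_continuous : {within `[0, 1], continuous be};
  loop_ph_continuous : {within `[-1, 1], continuous ph};
  loop_be_sphere : forall s, 0 <= s <= 1 -> unit_sphere R 2 (be s);
  loop_ph_sphere : forall u, -1 <= u <= 1 -> unit_sphere R 2 (ph u);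
  loop_be_inj : forall s t, 0 <= s <= 1 -> 0 <= t <= 1 -> be s = be t -> s = t;
  loop_ph_inj : forall u v, -1 <= u <= 1 -> -1 <= v <= 1 -> ph u = ph v -> u = v;
  loop_start : be 0 = ph (-1);
  loop_end : be 1 = ph 1;
  loop_meet : forall s u, 0 <= s <= 1 -> -1 <= u <= 1 -> be s = ph u ->
    (s = 0 /\ u = -1) \/ (s = 1 /\ u = 1);
  loop_cover : forall z, unit_sphere R 2 z ->
    (exists2 s, 0 <= s <= 1 & z = be s) \/ (exists2 u, -1 <= u <= 1 & z = ph u)
}.

Lemma circle_to_square_boundary (be ph : R -> 'rV[R]_2) :
  loop_decomposition be ph -> exists psi : 'rV[R]_2 -> R * R,
  [/\ forall s, 0 <= s <= 1 -> psi (be s) = (s, 0),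
      forall u, -1 <= u <= 1 -> psi (ph u) = side u,
      {within unit_sphere R 2, continuous (fun z => (psi z).1)},
      {within unit_sphere R 2, continuous (fun z => (psi z).2)} &
      forall z z', unit_sphere R 2 z -> unit_sphere R 2 z' -> psi z = psi z' ->
        z = z'].
Proof.
case=> cbe cph bes phs be_inj ph_inj be0 be1 meet cover.
have [side0 side1] := side_ends.
have [psi psiP] : {psi : 'rV[R]_2 -> R * R & forall z,
    (forall s, 0 <= s <= 1 -> z = be s -> psi z = (s, 0)) /\
    (forall u, -1 <= u <= 1 -> z = ph u -> psi z = side u)}.
  apply: (@choice _ _ (fun z p =>
    (forall s, 0 <= s <= 1 -> z = be s -> p = (s, 0)) /\
    (forall u, -1 <= u <= 1 -> z = ph u -> p = side u))) => z.
  have [[s s01 zs]|nos] := pselect (exists2 s, 0 <= s <= 1 & z = be s).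
    exists (s, 0); split=> [t t01|u uI].
      by rewrite zs => /be_inj ->.
    by rewrite zs => /(meet _ _ s01 uI)[[-> ->]|[-> ->]].
  have [[u uI zu]|nou] := pselect (exists2 u, -1 <= u <= 1 & z = ph u).
    exists (side u); split=> [s s01 zs|v vI].
      by case: nos; exists s.
    by rewrite zu => /ph_inj ->.
  exists (0, 0); split=> [s s01 zs|u uI zu].
    by case: nos; exists s.
  by case: nou; exists u.
have psi_be s : 0 <= s <= 1 -> psi (be s) = (s, 0).
  by move=> s01; apply: (psiP _).1.
have psi_ph u : -1 <= u <= 1 -> psi (ph u) = side u.
  by move=> uI; apply: (psiP _).2.
have sphereE : unit_sphere R 2 = be @` `[0, 1] `|` ph @` `[-1, 1].
  apply/seteqP; split=> z.
    move=> /cover[[s s01 ->]|[u uI ->]]; [left|right].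
      by exists s => //; apply/segmentP.
    by exists u => //; apply/segmentP.
  move=> [[s /segmentP s01 <-]|[u /segmentP uI <-]]; first exact: bes.
  exact: phs.
have hV : hausdorff_space 'rV[R]_2 by exact: norm_hausdorff.
have cpt01 : compact `[0 : R, 1] by exact: segment_compact.
have cpt11 : compact `[-1 : R, 1] by exact: segment_compact.
have cl_be : closed (be @` `[0, 1]).
  by apply: compact_closed => //; exact: continuous_compact.
have cl_ph : closed (ph @` `[-1, 1]).
  by apply: compact_closed => //; exact: continuous_compact.
exists psi; split=> //.
- rewrite sphereE; apply: withinU_continuous => //.
    apply: (factor_continuous (g := id)) => //.
      by apply: continuous_subspaceT; exact: continuous_id_fun.
    by move=> s /segmentP s01; rewrite psi_be.
  apply: (factor_continuous (g := fun u => (side u).1)) => //.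
    by apply: continuous_subspaceT; rewrite /side /=; cont.
  by move=> u /segmentP uI; rewrite psi_ph.
- rewrite sphereE; apply: withinU_continuous => //.
    apply: (factor_continuous (g := fun=> 0)) => //.
      by apply: continuous_subspaceT; exact: continuous_cst_fun.
    by move=> s /segmentP s01; rewrite psi_be.
  apply: (factor_continuous (g := fun u => (side u).2)) => //.
    by apply: continuous_subspaceT; rewrite /side /=; cont.
  by move=> u /segmentP uI; rewrite psi_ph.
- move=> z z' /cover[[s sI ->]|[u uI ->]] /cover[[t tI ->]|[v vI ->]].
  + by rewrite !psi_be // => -[->].
  + rewrite psi_be // psi_ph // => /esym/(side_bottom vI)[] [-> ->] //.
  + by rewrite psi_be // psi_ph // => /(side_bottom uI)[] [-> ->].
  + by rewrite !psi_ph // => /side_inj ->.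
Qed.

(** The boundary map is extended by coning from the centre [(1/2, 1/2)] of the
    square.  The cone is continuous since the disc is a quotient of the product of
    the circle with the interval of radii. *)
Lemma disc_to_square (be ph : R -> 'rV[R]_2) : loop_decomposition be ph ->
  exists q : 'rV[R]_2 -> R * R,
  [/\ {within closed_disc R 2, continuous (fun z => (q z).1)},
      {within closed_disc R 2, continuous (fun z => (q z).2)},
      (forall z, closed_disc R 2 z -> unit_square (q z)) /\
      (forall z z', closed_disc R 2 z -> closed_disc R 2 z' -> q z = q z' -> z = z'),
      forall s, 0 <= s <= 1 -> q (be s) = (s, 0) &
      forall u, -1 <= u <= 1 -> open_sides (q (ph u))].
Proof.
move=> loop; have [psi [psi_be psi_ph cpsi1 cpsi2 psi_inj]] :=
  circle_to_square_boundary loop.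
case: loop => _ _ bes phs _ _ _ _ _ cover.
pose rad (z : 'rV[R]_2) := Num.sqrt (sqnorm z).
pose q (z : 'rV[R]_2) : R * R :=
  (1 / 2 + rad z * ((psi ((rad z)^-1 *: z)).1 - 1 / 2),
   1 / 2 + rad z * ((psi ((rad z)^-1 *: z)).2 - 1 / 2)).
have radZ r w : 0 <= r -> unit_sphere R 2 w -> rad (r *: w) = r.
  by move=> r0 w1; rewrite /rad sqnormZ w1 mulr1 sqrtr_sqr ger0_norm.
have qZ r w : 0 <= r -> unit_sphere R 2 w -> q (r *: w) =
    (1 / 2 + r * ((psi w).1 - 1 / 2), 1 / 2 + r * ((psi w).2 - 1 / 2)).
  move=> r0 w1; rewrite /q radZ //; have [->|rN0] := eqVneq r 0.
    by rewrite !mul0r.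
  by rewrite scalerA mulVf // scale1r.
have q1 w : unit_sphere R 2 w -> q w = psi w.
  move=> w1; rewrite -[w in LHS]scale1r qZ ?ler01 // !mul1r.
  rewrite [RHS]surjective_pairing; congr (_, _); lra.
pose A : set ('rV[R]_2 * R) := unit_sphere R 2 `*` `[0, 1].
have polar z : closed_disc R 2 z ->
    exists2 r, 0 <= r <= 1 & exists2 w, unit_sphere R 2 w & z = r *: w.
  move=> z1; have rz : rad z ^+ 2 = sqnorm z by rewrite sqr_sqrtr ?sqnorm_ge0.
  exists (rad z).
    rewrite sqrtr_ge0 /= -(@ler_pXn2r _ 2) ?nnegrE ?sqrtr_ge0 //.
    by rewrite rz expr1n.
  have [z0|zN0] := eqVneq (rad z) 0.
    exists (be 0); first by apply: bes; rewrite lexx ler01.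
    by rewrite z0 scale0r; apply: sqnorm_eq0; rewrite -rz z0 expr0n.
  exists ((rad z)^-1 *: z); last by rewrite scalerA mulfV // scale1r.
  by rewrite /unit_sphere /= sqnormZ -rz -exprMn mulVf // expr1n.
have discE : closed_disc R 2 = (fun p : 'rV[R]_2 * R => p.2 *: p.1) @` A.
  apply/seteqP; split=> z.
    move=> /polar[r r01 [w w1 ->]]; exists (w, r) => //.
  move=> [[w r] [w1 /segmentP/andP[r0 r1]] <-]; rewrite /closed_disc /=.
  by rewrite sqnormZ w1 mulr1 -(expr1n _ 2) ler_pXn2r // nnegrE.
have cptA : compact A.
  by apply: compact_setX; [exact: compact_unit_sphere | exact: segment_compact].
have cfst : continuous (fun p : 'rV[R]_2 * R => p.1) by move=> p; exact: cvg_fst.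
have csnd : continuous (fun p : 'rV[R]_2 * R => p.2) by move=> p; exact: cvg_snd.
have cscale : {within A, continuous (fun p : 'rV[R]_2 * R => p.2 *: p.1)}.
  apply: continuous_subspaceT => p; apply: continuous_rV => i.
  have -> : (fun p : 'rV[R]_2 * R => (p.2 *: p.1) ord0 i) =
            (fun p => p.2 * p.1 ord0 i) by apply/funext => p'; rewrite mxE.
  apply: continuous_mul => // p'.
  exact: (cvg_comp _ _ (cfst p') (@coord_continuous R 1 2 ord0 i p'.1)).
have cradial (h : 'rV[R]_2 -> R) : {within unit_sphere R 2, continuous h} ->
    {within A, continuous (fun p => 1 / 2 + p.2 * (h p.1 - 1 / 2))}.
  move=> ch; apply: continuous_add; first exact: continuous_cst_fun.
  apply: continuous_mul; first exact: continuous_subspaceT.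
  apply: continuous_add; last exact: continuous_cst_fun.
  apply: (comp_within_continuous (B := unit_sphere R 2)) => //.
    exact: continuous_subspaceT.
  by move=> p [].
have on_side w : unit_sphere R 2 w -> unit_square (psi w) /\
    [\/ (psi w).1 = 0, (psi w).1 = 1, (psi w).2 = 0 | (psi w).2 = 1].
  move=> /cover[[s sI ->]|[u uI ->]].
    by rewrite psi_be //; split; [split=> //=; rewrite lexx ler01 | exact: Or43].
  rewrite psi_ph //; have [sq [->|->|->]] := side_square uI; split=> //.
  - exact: Or41.
  - exact: Or42.
  - exact: Or44.
have hV : hausdorff_space 'rV[R]_2 by exact: norm_hausdorff.
exists q; split.
- rewrite discE; apply: (factor_continuous hV cptA cscale (cradial _ cpsi1)).
  by move=> [w r] [w1 /segmentP/andP[r0 _]]; rewrite qZ.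
- rewrite discE; apply: (factor_continuous hV cptA cscale (cradial _ cpsi2)).
  by move=> [w r] [w1 /segmentP/andP[r0 _]]; rewrite qZ.
- split=> [z /polar[r /andP[r0 r1] [w w1 ->]]|].
    rewrite qZ //; have [[/andP[a0 a1] /andP[b0 b1]] _] := on_side _ w1.
    by split; apply/andP; split => /=; nra.
  move=> z z' /polar[r /andP[r0 r1] [w w1 ->]] /polar[r' /andP[r'0 r'1] [w' w'1 ->]].
  rewrite !qZ // => -[E1 E2].
  (* The maximum norm of [psi w - (1/2, 1/2)] is 1/2, so it recovers the radius. *)
  have rr' : r = r'.
    have [[/andP[a0 a1] /andP[b0 b1]] sd] := on_side _ w1.
    have [[/andP[a'0 a'1] /andP[b'0 b'1]] sd'] := on_side _ w'1.
    by case: sd => Es; rewrite Es in E1 E2; case: sd' => Es'; rewrite Es' in E1 E2; nra.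
  rewrite rr' in E1 E2 *; have [->|rN0] := eqVneq r' 0; first by rewrite !scale0r.
  congr (_ *: _); apply: psi_inj => //.
  rewrite [psi w]surjective_pairing [psi w']surjective_pairing.
  by congr (_, _); [move: E1|move: E2] => /addrI/(mulfI rN0)/addIr.
- by move=> s sI; rewrite q1 ?psi_be //; exact: bes.
- move=> u uI; rewrite q1 ?psi_ph //; last exact: phs.
  exact: (side_square uI).2.
Qed.

End DiscToSquare.

(** * The complement of an arc in the circle *)

Section Rays.
Variable R : realType.

Lemma IVT_within (f : R -> R) (a b v : R) : a <= b ->
  {within `[a, b], continuous f} -> f a <= v <= f b \/ f b <= v <= f a ->
  exists2 c, a <= c <= b & f c = v.
Proof.
move=> ab cf fv; have [||c cab <-] := @IVT R f a b v ab => //.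
  by rewrite ge_min le_max; case: fv => /andP[-> ->]; rewrite ?orbT.
by exists c => //; rewrite in_itv /= in cab.
Qed.

Lemma within_segmentS (f : R -> R) (a b a' b' : R) : a <= a' -> b' <= b ->
  {within `[a, b], continuous f} -> {within `[a', b'], continuous f}.
Proof.
move=> aa' bb'; apply: continuous_subspaceW => x /segmentP/andP[h1 h2].
by apply/segmentP; rewrite (le_trans aa') ?(le_trans h2).
Qed.

Definition blows_up (g : R -> R) := forall M, exists2 dl, 0 < dl <= 1 &
  forall u, 0 < u <= dl -> M < `|g u|.

(** Were [g] below [g 1] somewhere, it would take the value [g 1] once more, on the
    way to [u1].  So it stays above [g 1], and the only infinity it can tend to is
    the positive one. *)
Lemma half_open_arc_ray_pos (g : R -> R) u1 :
  (forall a, 0 < a <= 1 -> {within `[a, 1], continuous g}) ->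
  (forall u v, 0 < u <= 1 -> 0 < v <= 1 -> g u = g v -> u = v) ->
  blows_up g -> 0 < u1 < 1 -> `|g 1| < g u1 ->
  (forall u, 0 < u <= 1 -> g 1 <= g u) /\
  (forall y, g 1 <= y -> exists2 u, 0 < u <= 1 & g u = y).
Proof.
move=> cg inj_g blow /andP[u10 u11] gu1.
have g1u1 : g 1 < g u1 by apply: le_lt_trans gu1; exact: ler_norm.
have I1 : 0 < (1 : R) <= 1 by rewrite ltr01 lexx.
have ge1 u : 0 < u <= 1 -> g 1 <= g u.
  move=> /andP[u0 u1']; rewrite leNgt; apply/negP => gu.
  have hit a b : 0 < a -> a <= b -> b < 1 ->
      g a <= g 1 <= g b \/ g b <= g 1 <= g a -> False.
    move=> a0 ab b1 h.
    have [|c /andP[ac cb] gc] := IVT_within ab _ h.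
      apply: within_segmentS (cg a _) => //; first exact: ltW.
      by rewrite a0 (le_trans ab) // ltW.
    have c1 : c = 1.
      by apply: inj_g => //; rewrite (lt_le_trans a0 ac) (le_trans cb) // ltW.
    by move: cb; rewrite c1 leNgt b1.
  have [uu1|u1u] := leP u u1.
    by apply: (hit u u1) => //; left; rewrite !ltW.
  have [ueq1|uN1] := eqVneq u 1; first by move: gu; rewrite ueq1 ltxx.
  apply: (hit u1 u) => //; [exact: ltW | by rewrite lt_neqAle uN1 |].
  by right; rewrite !ltW.
split=> // y g1y; have [dl /andP[dl0 dl1] dlP] := blow (`|y| + `|g 1|).
have gdl := dlP dl; rewrite dl0 lexx in gdl; have {}gdl := gdl isT.
have gdl_ge : g 1 <= g dl by apply: ge1; rewrite dl0.
have y_gdl : y <= g dl.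
  move: gdl; case: (ger0P (g dl)) => h; have := ler_norm y.
    by have := normr_ge0 (g 1); lra.
  have := ler_norm (- g 1); rewrite normrN.
  by have := normr_ge0 y; lra.
have [||c /andP[dc c1] gc] := @IVT_within g dl 1 y dl1.
- by apply: cg; rewrite dl0.
- by right; rewrite g1y.
- by exists c => //; rewrite (lt_le_trans dl0).
Qed.

(** An injective continuous image of a half-open interval in the line, running
    off to infinity at the open end, is a closed ray; [e] is its direction. *)
Lemma half_open_arc_ray (g : R -> R) :
  (forall a, 0 < a <= 1 -> {within `[a, 1], continuous g}) ->
  (forall u v, 0 < u <= 1 -> 0 < v <= 1 -> g u = g v -> u = v) ->
  blows_up g -> exists2 e : R, e = 1 \/ e = -1 &
  (forall u, 0 < u <= 1 -> e * g 1 <= e * g u) /\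
  (forall y, e * g 1 <= e * y -> exists2 u, 0 < u <= 1 & g u = y).
Proof.
move=> cg inj_g blow; have [dl /andP[dl0 dl1] dlP] := blow `|g 1|.
have gdl := dlP dl; rewrite dl0 lexx in gdl; have {}gdl := gdl isT.
have {}dl1 : dl < 1.
  rewrite lt_neqAle dl1 andbT; apply/eqP => E.
  by move: gdl; rewrite E ltxx.
have [gpos|gneg] := leP 0 (g dl).
  exists 1; first by left.
  have [|||||h1 h2] := @half_open_arc_ray_pos g dl => //; first by rewrite dl0.
    by rewrite (ger0_norm gpos) in gdl.
  split=> [u|y]; first by rewrite !mul1r; exact: h1.
  by rewrite !mul1r; exact: h2.
exists (-1); first by right.
have [|||||h1 h2] := @half_open_arc_ray_pos (fun u => - g u) dl => //.
- by move=> a aI; apply: continuous_opp; exact: cg.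
- by move=> u v uI vI /oppr_inj/inj_g; apply.
- by move=> M; have [dl' dl'I dl'P] := blow M; exists dl' => // u /dl'P; rewrite normrN.
- by rewrite dl0.
- by rewrite normrN; rewrite (ltr0_norm gneg) in gdl.
split=> [u|y]; first by rewrite !mulN1r; exact: h1.
rewrite !mulN1r => /h2[u uI E]; exists u => //; exact: oppr_inj.
Qed.

End Rays.

Section ArcComplement.
Variable R : realType.

Definition vec2 (a b : R) : 'rV[R]_2 := \row_i (if i == ord0 then a else b).

Lemma vec2_0 a b : vec2 a b ord0 ord0 = a.
Proof. by rewrite mxE. Qed.

Lemma vec2_1 a b : vec2 a b ord0 ord_max = b.
Proof. by rewrite mxE. Qed.

Lemma vec2E (z : 'rV[R]_2) : z = vec2 (z ord0 ord0) (z ord0 ord_max).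
Proof.
apply/rowP => i; rewrite mxE; case: eqP => [->|/eqP iN0] //; congr (z _ _).
by apply/val_inj => /=; case: i iN0 => -[|[|m]].
Qed.

Lemma sqnorm2 (z : 'rV[R]_2) : sqnorm z = z ord0 ord0 ^+ 2 + z ord0 ord_max ^+ 2.
Proof.
rewrite /sqnorm big_ord_recl big_ord_recl big_ord0 addr0.
by congr (_ ^+ 2 + z _ _ ^+ 2); apply/val_inj.
Qed.

Definition clamp (u : R) : R := Num.max (-1) (Num.min 1 u).

Lemma clampE u : -1 <= u <= 1 -> clamp u = u.
Proof. by move=> /andP[u0 u1]; rewrite /clamp min_r // max_r. Qed.

Lemma clamp_in u : -1 <= clamp u <= 1.
Proof.
rewrite /clamp le_max lexx /= ge_max ge_min lexx /= andbT; lra.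
Qed.

Lemma clamp_continuous (U : topologicalType) (f : R -> U) :
  {within `[-1, 1], continuous f} -> continuous (fun u => f (clamp u)).
Proof.
move=> cf; apply/continuous_subspace_setT.
apply: (@comp_within_continuous R R U setT `[-1, 1]%classic clamp f _ cf).
  by apply: continuous_subspaceT; rewrite /clamp; cont.
by move=> x _; apply/segmentP; exact: clamp_in.
Qed.

Section Stereographic.
Variable z0 : 'rV[R]_2.
Hypothesis z0_sphere : unit_sphere R 2 z0.

Let p := z0 ord0 ord0.
Let q := z0 ord0 ord_max.

Let pq1 : p ^+ 2 + q ^+ 2 = 1.
Proof. by rewrite -sqnorm2; exact: z0_sphere. Qed.

(** With [z0] and [z] seen as complex numbers, [inner2 z] and [cross2 z] are the
    real and imaginary parts of [z / z0]. *)
Definition inner2 (z : 'rV[R]_2) : R := p * z ord0 ord0 + q * z ord0 ord_max.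

Definition cross2 (z : 'rV[R]_2) : R := p * z ord0 ord_max - q * z ord0 ord0.

Lemma inner2_continuous : continuous inner2.
Proof.
have c0 := @coord_continuous R 1 2 ord0 ord0.
have c1 := @coord_continuous R 1 2 ord0 ord_max.
by rewrite /inner2; cont.
Qed.

Lemma cross2_continuous : continuous cross2.
Proof.
have c0 := @coord_continuous R 1 2 ord0 ord0.
have c1 := @coord_continuous R 1 2 ord0 ord_max.
by rewrite /cross2; cont.
Qed.

Lemma inner2_cross2 z : unit_sphere R 2 z -> inner2 z ^+ 2 + cross2 z ^+ 2 = 1.
Proof.
rewrite /unit_sphere /= sqnorm2 => z1; rewrite /inner2 /cross2.
transitivity ((p ^+ 2 + q ^+ 2) * (z ord0 ord0 ^+ 2 + z ord0 ord_max ^+ 2)).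
  by ring.
by rewrite pq1 z1 mulr1.
Qed.

Lemma inner2_cross2E z :
  z = vec2 (p * inner2 z - q * cross2 z) (q * inner2 z + p * cross2 z).
Proof.
rewrite [LHS]vec2E; congr vec2.
  by transitivity ((p ^+ 2 + q ^+ 2) * z ord0 ord0);
    [rewrite pq1 mul1r | rewrite /inner2 /cross2; ring].
by transitivity ((p ^+ 2 + q ^+ 2) * z ord0 ord_max);
  [rewrite pq1 mul1r | rewrite /inner2 /cross2; ring].
Qed.

Lemma inner2_id : inner2 z0 = 1.
Proof. by rewrite /inner2 -!expr2. Qed.

Lemma inner2_lt1 z : unit_sphere R 2 z -> z <> z0 -> inner2 z < 1.
Proof.
move=> z1 zN; have cs := inner2_cross2 z1; rewrite lt_neqAle; apply/andP; split.
  apply/eqP => c1; apply: zN; rewrite c1 expr1n in cs.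
  have s0 : cross2 z = 0 by apply/eqP; rewrite -sqrf_eq0; apply/eqP; lra.
  rewrite [LHS]inner2_cross2E c1 s0 [RHS]vec2E -/p -/q; congr vec2; ring.
by have := sqr_ge0 (cross2 z); nra.
Qed.

(** The stereographic projection from [z0], and its inverse. *)
Definition stereo (z : 'rV[R]_2) : R := cross2 z / (1 - inner2 z).

Definition unstereo (w : R) : 'rV[R]_2 :=
  vec2 ((p * (w ^+ 2 - 1) - q * (2 * w)) / (w ^+ 2 + 1))
       ((q * (w ^+ 2 - 1) + p * (2 * w)) / (w ^+ 2 + 1)).

Let w1N0 (w : R) : w ^+ 2 + 1 != 0.
Proof. by rewrite gt_eqF // ltr_wpDl ?sqr_ge0. Qed.

Lemma unstereo_continuous : continuous unstereo.
Proof.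
apply: continuous_rV => i.
have cinv : continuous (fun w : R => (w ^+ 2 + 1)^-1).
  move=> w; apply: cvgV; first exact: w1N0.
  have : continuous (fun w : R => w * w + 1) by cont.
  by have -> : (fun w : R => w * w + 1) = (fun w => w ^+ 2 + 1) by []; apply.
have -> : (fun w => unstereo w ord0 i) = (fun w =>
    (if i == ord0 then p * (w * w - 1) - q * (2 * w)
     else q * (w * w - 1) + p * (2 * w)) * (w ^+ 2 + 1)^-1).
  by apply/funext => w; rewrite mxE; case: eqP.
by apply: continuous_mul => //; case: eqP => _; cont.
Qed.

Lemma inner2_unstereo w : inner2 (unstereo w) = (w ^+ 2 - 1) / (w ^+ 2 + 1).
Proof.
rewrite /inner2 /unstereo vec2_0 vec2_1.
transitivity ((p ^+ 2 + q ^+ 2) * ((w ^+ 2 - 1) / (w ^+ 2 + 1))).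
  by field; exact: w1N0.
by rewrite pq1 mul1r.
Qed.

Lemma unstereoK w : stereo (unstereo w) = w.
Proof.
have cr : cross2 (unstereo w) = 2 * w / (w ^+ 2 + 1).
  rewrite /cross2 /unstereo vec2_0 vec2_1.
  transitivity ((p ^+ 2 + q ^+ 2) * (2 * w / (w ^+ 2 + 1))).
    by field; exact: w1N0.
  by rewrite pq1 mul1r.
rewrite /stereo inner2_unstereo cr; field.
by rewrite w1N0 /=; apply/eqP => E; have := w1N0 w; apply/negP; rewrite negbK;
   apply/eqP; lra.
Qed.

Lemma unstereo_sphere w : unit_sphere R 2 (unstereo w).
Proof.
rewrite /unit_sphere /= sqnorm2 vec2_0 vec2_1.
transitivity ((p ^+ 2 + q ^+ 2) * (((w ^+ 2 - 1) ^+ 2 + (2 * w) ^+ 2)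
   / (w ^+ 2 + 1) ^+ 2)); first by field; exact: w1N0.
by rewrite pq1; field; exact: w1N0.
Qed.

Lemma unstereo_neq w : unstereo w <> z0.
Proof.
move=> E; have := inner2_unstereo w; rewrite E inner2_id.
by move=> /(congr1 (fun t => t * (w ^+ 2 + 1))); rewrite mulfVK //; lra.
Qed.

(** This shows that [stereo] tends to infinity at [z0]. *)
Lemma stereo_sqr z : unit_sphere R 2 z -> z <> z0 ->
  stereo z ^+ 2 + 1 = 2 / (1 - inner2 z).
Proof.
move=> z1 zN; have c1 := inner2_lt1 z1 zN; have cs := inner2_cross2 z1.
have dN0 : 1 - inner2 z != 0 by rewrite gt_eqF // subr_gt0.
rewrite /stereo; apply: (@mulIf _ ((1 - inner2 z) ^+ 2)); first by rewrite sqrf_eq0.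
transitivity (cross2 z ^+ 2 + (1 - inner2 z) ^+ 2); first by field.
transitivity (2 * (1 - inner2 z)); last by field.
have -> : cross2 z ^+ 2 = 1 - inner2 z ^+ 2 by lra.
by ring.
Qed.

Lemma stereoK z : unit_sphere R 2 z -> z <> z0 -> unstereo (stereo z) = z.
Proof.
move=> z1 zN; have Ew1 := stereo_sqr z1 zN.
have dN0 : 1 - inner2 z != 0 by rewrite gt_eqF // subr_gt0 inner2_lt1.
have Ec : (stereo z ^+ 2 - 1) / (stereo z ^+ 2 + 1) = inner2 z.
  have -> : stereo z ^+ 2 - 1 = 2 / (1 - inner2 z) - 2 by rewrite -Ew1; lra.
  by rewrite Ew1; field.
have Es : 2 * stereo z / (stereo z ^+ 2 + 1) = cross2 z.
  by rewrite Ew1 /stereo; field.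
rewrite [RHS]inner2_cross2E /unstereo; congr vec2.
  by rewrite -Ec -Es; field; exact: w1N0.
by rewrite -Ec -Es; field; exact: w1N0.
Qed.

End Stereographic.

Lemma circle_minus_point_connected (z0 : 'rV[R]_2) : unit_sphere R 2 z0 ->
  connected (unit_sphere R 2 `\ z0).
Proof.
move=> z01; have -> : unit_sphere R 2 `\ z0 = unstereo z0 @` [set: R].
  apply/seteqP; split=> z; last first.
    by move=> [w _ <-]; split; [exact: unstereo_sphere | exact: unstereo_neq].
  by move=> [z1 zN]; exists (stereo z0 z) => //; exact: stereoK.
apply: connected_continuous_connected.
  by apply/connected_intervalP.
by apply: continuous_subspaceT; exact: unstereo_continuous.
Qed.

(** In the stereographic coordinate centred at the middle point [ph 0] of the arc,
    the two halves of the arc are closed rays.  They are disjoint, so they point in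
    opposite directions and the complement is the segment [be] between their
    origins. *)
Lemma arc_complement (ph : R -> 'rV[R]_2) :
  {within `[-1, 1], continuous ph} ->
  (forall u, -1 <= u <= 1 -> unit_sphere R 2 (ph u)) ->
  (forall u v, -1 <= u <= 1 -> -1 <= v <= 1 -> ph u = ph v -> u = v) ->
  exists be, loop_decomposition be ph.
Proof.
move=> cph phs ph_inj.
have I0 : -1 <= (0 : R) <= 1 by lra.
have z01 := phs 0 I0; set z0 := ph 0 in z01.
pose st := stereo z0; pose unst := unstereo z0.
have st_unst w : st (unst w) = w by exact: unstereoK.
have unst_sphere w : unit_sphere R 2 (unst w) by exact: unstereo_sphere.
have unst_ph0 w : unst w <> ph 0 by exact: unstereo_neq.
have unst_st z : unit_sphere R 2 z -> z <> ph 0 -> unst (st z) = z.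
  exact: stereoK.
pose C u := inner2 z0 (ph (clamp u)); pose S u := cross2 z0 (ph (clamp u)).
have cC : continuous C.
  by move=> u; exact: (cvg_comp _ _ (clamp_continuous cph (x := u))
    (@inner2_continuous z0 _)).
have cS : continuous S.
  by move=> u; exact: (cvg_comp _ _ (clamp_continuous cph (x := u))
    (@cross2_continuous z0 _)).
pose g u := S u / (1 - C u).
have gE u : -1 <= u <= 1 -> g u = st (ph u).
  by move=> uI; rewrite /g /st /stereo /C /S clampE.
have C_lt1 u : -1 <= u <= 1 -> u != 0 -> C u < 1.
  move=> uI uN0; rewrite /C clampE //; apply: inner2_lt1 => //; first exact: phs.
  by move=> /ph_inj E; move: uN0; rewrite E ?eqxx.
have g_inj u v : -1 <= u <= 1 -> -1 <= v <= 1 -> u != 0 -> v != 0 ->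
    g u = g v -> u = v.
  move=> uI vI uN0 vN0; rewrite !gE // => E; apply: (ph_inj u v) => //.
  rewrite -(unst_st (ph u)) ?E ?unst_st //; try exact: phs.
    by move=> /ph_inj E'; move: vN0; rewrite E' ?eqxx.
  by move=> /ph_inj E'; move: uN0; rewrite E' ?eqxx.
have cg u : -1 <= u <= 1 -> u != 0 -> {for u, continuous g}.
  move=> uI uN0; apply: cvgM; first exact: cS.
  apply: cvgV; first by rewrite gt_eqF // subr_gt0 C_lt1.
  by apply: cvgB; [exact: cvg_cst | exact: cC].
have pm_neq0 (sg : R) : sg = 1 \/ sg = -1 -> sg != 0.
  by case=> ->; rewrite ?oppr_eq0 oner_eq0.
have blow (sg : R) : sg = 1 \/ sg = -1 -> blows_up (fun u => g (sg * u)).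
  move=> sgE M.
  have C0 : C 0 = 1 by rewrite /C clampE //; exact: inner2_id.
  have cCsg : continuous (fun u => C (sg * u)).
    by apply: (@continuous_comp1 R R C (fun u => sg * u) cC); cont.
  have e0 : 0 < (M ^+ 2 + 1)^-1 by rewrite invr_gt0 ltr_wpDl ?sqr_ge0.
  have /cvgrPdist_lt/(_ _ e0) : C (sg * u) @[u --> (0 : R)] --> C (sg * 0).
    exact: cCsg.
  move=> /nbhs_ballP[d /= d0 dP].
  have m0 : 0 < Num.min (d / 2) 1 by rewrite lt_min ltr01 andbT divr_gt0.
  exists (Num.min (d / 2) 1); first by rewrite m0 ge_min lexx orbT.
  move=> u /andP[u0]; rewrite le_min => /andP[ud u1].
  have uI : -1 <= sg * u <= 1 by case: sgE => ->; lra.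
  have uN0 : sg * u != 0 by apply: mulf_neq0; [exact: pm_neq0 | rewrite gt_eqF].
  have := dP u; rewrite /ball /= sub0r normrN (gtr0_norm u0) mulr0 C0.
  have ud' : u < d by lra.
  move=> /(_ ud'); have c1 := C_lt1 _ uI uN0.
  rewrite gtr0_norm ?subr_gt0 // => h.
  rewrite ltNge; apply/negP => gM.
  have g2 : g (sg * u) ^+ 2 <= M ^+ 2.
    rewrite -(real_normK (num_real (g _))) ler_pXn2r ?nnegrE ?normr_ge0 //.
    exact: le_trans (normr_ge0 _) gM.
  have dN0 : 1 - C (sg * u) != 0 by rewrite gt_eqF // subr_gt0.
  have Ew1 : g (sg * u) ^+ 2 + 1 = 2 / (1 - C (sg * u)).
    rewrite gE // /C clampE //; apply: stereo_sqr => //; first exact: phs.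
    by move=> /ph_inj E; move: uN0; rewrite E ?eqxx.
  have : 2 / (1 - C (sg * u)) <= M ^+ 2 + 1 by rewrite -Ew1 lerD2r.
  rewrite ler_pdivrMr ?subr_gt0 // => h2.
  have : (1 - C (sg * u)) * (M ^+ 2 + 1) < 1.
    by rewrite -ltr_pdivlMr ?div1r // -invr_gt0.
  by rewrite mulrC; lra.
have ray (sg : R) : sg = 1 \/ sg = -1 -> exists2 e : R, e = 1 \/ e = -1 &
    (forall u, 0 < u <= 1 -> e * g sg <= e * g (sg * u)) /\
    (forall w, e * g sg <= e * w -> exists2 u, 0 < u <= 1 & g (sg * u) = w).
  move=> sgE; have sgN0 := pm_neq0 _ sgE.
  have sgI u : 0 < u <= 1 -> -1 <= sg * u <= 1 by case: sgE => ->; lra.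
  have [||e eE] := @half_open_arc_ray R (fun u => g (sg * u)) _ _ (blow _ sgE).
  - move=> a /andP[a0 a1]; apply: continuous_in_subspaceT => u /set_mem/segmentP.
    move=> /andP[au u1].
    have uI : 0 < u <= 1 by rewrite (lt_le_trans a0).
    apply: (@continuous_comp _ _ _ (fun u => sg * u) g).
      by apply: cvgM; [exact: cvg_cst | exact: cvg_id].
    apply: cg; first exact: sgI.
    by rewrite mulf_neq0 // gt_eqF //; case/andP: uI.
  - move=> u v uI vI /g_inj E; apply: (mulfI sgN0); apply: E.
    + exact: sgI.
    + exact: sgI.
    + by rewrite mulf_neq0 // gt_eqF //; case/andP: uI.
    + by rewrite mulf_neq0 // gt_eqF //; case/andP: vI.
  - by rewrite mulr1 => h; exists e.
have [e eE [e1 e2]] := ray 1 (or_introl erefl).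
have [e' e'E [e'1 e'2]] := ray (-1) (or_intror erefl).
have eN : e' = - e.
  have [//|ee'] : e' = - e \/ e' = e by case: eE e'E => -> []->; rewrite ?opprK; auto.
  (* Otherwise the origin [w] of the shorter ray is on both rays. *)
  exfalso; pose w := e * Num.max (e * g 1) (e * g (-1)).
  have ee : e * e = 1 by case: eE => ->; lra.
  have ew : e * w = Num.max (e * g 1) (e * g (-1)) by rewrite /w mulrA ee mul1r.
  have [|u uI gu] := e2 w; first by rewrite ew le_max lexx.
  have [|v vI gv] := e'2 w; first by rewrite ee' ew le_max lexx orbT.
  have [/andP[u0 u1] /andP[v0 v1]] := (uI, vI).
  have : 1 * u = -1 * v.
    by apply: g_inj; rewrite ?gu ?gv ?mul1r ?mulN1r ?oppr_eq0 ?gt_eqF //; lra.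
  by lra.
rewrite {e'E}eN in e'1 e'2.
have gap : e * g (-1) < e * g 1.
  rewrite ltNge; apply/negP => h.
  have [|u uI gu] := e2 (g (-1)); first by [].
  have /andP[u0 u1] := uI.
  have : 1 * u = -1.
    by apply: g_inj => //; rewrite ?mul1r ?oppr_eq0 ?oner_eq0 ?gt_eqF //; lra.
  by lra.
pose mid s := (1 - s) * g (-1) + s * g 1.
exists (fun s => unst (mid s)); split=> //.
- have cmid : continuous mid by rewrite /mid; cont.
  apply: continuous_subspaceT => s.
  exact: (cvg_comp _ _ (cmid s) (@unstereo_continuous z0 _)).
- move=> s t sI tI /(congr1 st); rewrite !st_unst /mid => E.
  have : (s - t) * (g 1 - g (-1)) = 0 by lra.
  move=> /eqP; rewrite mulf_eq0 !subr_eq0 => /orP[/eqP //|/eqP E'].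
  by rewrite E' ltxx in gap.
- have I : -1 <= (-1 : R) <= 1 by lra.
  have -> : mid 0 = st (ph (-1)) by rewrite /mid -gE //; lra.
  rewrite unst_st //; first exact: phs.
  move=> /(ph_inj _ _ I I0)/eqP; by rewrite oppr_eq0 oner_eq0.
- have I : -1 <= (1 : R) <= 1 by lra.
  have -> : mid 1 = st (ph 1) by rewrite /mid -gE //; lra.
  rewrite unst_st //; first exact: phs.
  move=> /(ph_inj _ _ I I0)/eqP; by rewrite oner_eq0.
- move=> s u sI uI E.
  have [u0|uN0] := eqVneq u 0; first by case: (unst_ph0 (mid s)); rewrite E u0.
  have {}E : mid s = g u by rewrite gE // -E st_unst.
  have Ee : e * mid s = (1 - s) * (e * g (-1)) + s * (e * g 1) by rewrite /mid; ring.
  have [upos|uneg] : 0 < u \/ u < 0 by move: uN0; rewrite neq_lt => /orP[]; auto.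
    right; have uI' : 0 < u <= 1 by rewrite upos; case/andP: uI.
    have := e1 _ uI'; rewrite mul1r -E Ee => h.
    have s1 : s = 1 by nra.
    split=> //; apply: g_inj; rewrite ?oppr_eq0 ?oner_eq0 //; first lra.
    by rewrite -E /mid s1; ring.
  left; have uI' : 0 < - u <= 1 by lra.
  have := e'1 _ uI'; rewrite mulrNN mul1r -E !mulNr lerN2 Ee => h.
  have s0 : s = 0 by nra.
  split=> //; apply: g_inj; rewrite ?oppr_eq0 ?oner_eq0 //; first lra.
  by rewrite -E /mid s0; ring.
- move=> z z1; have [->|zN0] := pselect (z = ph 0); first by right; exists 0.
  have zE : z = unst (st z) by rewrite unst_st.
  have phE u : -1 <= u <= 1 -> u != 0 -> g u = st z -> z = ph u.
    move=> uI uN0 E; rewrite zE -E gE // unst_st //; first exact: phs.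
    by move=> /ph_inj E'; move: uN0; rewrite E' ?eqxx.
  have [hi|hi] := leP (e * g 1) (e * st z).
    have [u uI gu] := e2 _ hi; right; exists u; first lra.
    by apply: phE; rewrite -?gu ?mul1r ?gt_eqF //; lra.
  have [lo|lo] := leP (e * st z) (e * g (-1)).
    have [|u uI gu] := e'2 (st z); first by rewrite !mulNr lerN2.
    right; exists (-1 * u); first lra.
    by apply: phE => //; [lra | rewrite mulN1r oppr_eq0 gt_eqF //; case/andP: uI].
  left; exists ((e * st z - e * g (-1)) / (e * g 1 - e * g (-1))).
    have d0 : 0 < e * g 1 - e * g (-1) by lra.
    rewrite divr_ge0 ?(ltW d0) //=; last by lra.
    by rewrite ler_pdivrMr //; lra.
  rewrite [LHS]zE; congr unst; rewrite /mid.
  have eN0 := pm_neq0 _ eE.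
  by field; rewrite -mulrBr mulf_neq0 // subr_eq0; apply/eqP => E;
     rewrite E ltxx in gap.
Qed.

End ArcComplement.

(** * Square roots of maps to the punctured plane *)

Section SquareRoots.
Variable R : realType.

Definition big_square : set (R * R) := `[-1, 1]%classic `*` `[-1, 1]%classic.

(** A complex number [z] has the square root [|z| + z] up to a positive factor,
    unless it is a negative real.  Here and below, pairs of reals stand for complex
    numbers, and square roots are only taken up to a positive factor. *)
Lemma complex_sqrt_const (a b : R) : 0 < a ^+ 2 + b ^+ 2 ->
  exists g1 g2 rho, [/\ 0 < rho, g1 ^+ 2 - g2 ^+ 2 = rho * a & 2 * g1 * g2 = rho * b].
Proof.
move=> ab; pose m := Num.sqrt (a ^+ 2 + b ^+ 2).
have m2 : m ^+ 2 = a ^+ 2 + b ^+ 2 by rewrite sqr_sqrtr // ltW.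
have m0 : 0 < m by rewrite sqrtr_gt0.
have [ma|ma] := eqVneq (m + a) 0.
  have b0 : b = 0 by apply/eqP; rewrite -sqrf_eq0; apply/eqP; nra.
  by exists 0, 1, m^-1; split; rewrite ?invr_gt0 // ?b0 ?mulr0 ?mul0r //;
    have -> : a = - m by [lra | ]; rewrite mulrN mulVf ?gt_eqF //; ring.
have ma0 : 0 < m + a.
  rewrite lt_neqAle eq_sym ma /=; have := ler_norm (- a); rewrite normrN => h.
  have : `|a| <= m.
    by rewrite -(@ler_pXn2r _ 2) ?nnegrE ?normr_ge0 ?(ltW m0) // m2 real_normK
       ?num_real // lerDl sqr_ge0.
  by lra.
exists (m + a), b, (2 * (m + a)); split; first by rewrite mulr_gt0.
  transitivity (m ^+ 2 + 2 * m * a + a ^+ 2 - b ^+ 2); first by ring.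
  by rewrite m2; ring.
by ring.
Qed.

Variables (k1 k2 : R * R -> R).
Hypothesis k1_cont : continuous k1.
Hypothesis k2_cont : continuous k2.
Hypothesis k_neq0 : forall z, 0 < k1 z ^+ 2 + k2 z ^+ 2.

Let at_ (k : R * R -> R) (t : R) (z : R * R) := k (t * z.1, t * z.2).

Let at_continuous k t : continuous k -> continuous (at_ k t).
Proof.
move=> ck; apply: (@continuous_comp2 R _ k (fun z => t * z.1) (fun z => t * z.2)) => //.
  by cont.
by cont.
Qed.

(** On a ray from the origin, the values of [k] at two close enough points have a
    positive scalar product; by compactness a single step size works everywhere. *)
Lemma uniform_half_plane : exists n : nat, forall (i : nat) z, (i < n.+1)%N ->
  big_square z ->
  0 < at_ k1 (i%:R / n.+1%:R) z * at_ k1 (i.+1%:R / n.+1%:R) z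
    + at_ k2 (i%:R / n.+1%:R) z * at_ k2 (i.+1%:R / n.+1%:R) z.
Proof.
(* [x] is the pair of [z] and the time along the ray, [s] is the step. *)
pose Phi (x : (R * R) * R) (s : R) : R :=
  at_ k1 x.2 x.1 * at_ k1 (x.2 + s) x.1 + at_ k2 x.2 x.1 * at_ k2 (x.2 + s) x.1.
have c1 : continuous (fun y : ((R * R) * R) * R => y.1.1.1).
  by move=> y; apply: cvg_comp; [apply: cvg_comp; exact: cvg_fst | exact: cvg_fst].
have c2 : continuous (fun y : ((R * R) * R) * R => y.1.1.2).
  by move=> y; apply: cvg_comp; [apply: cvg_comp; exact: cvg_fst | exact: cvg_snd].
have c3 : continuous (fun y : ((R * R) * R) * R => y.1.2).
  by move=> y; apply: cvg_comp; [exact: cvg_fst | exact: cvg_snd].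
have c4 : continuous (fun y : ((R * R) * R) * R => y.2).
  by move=> y; exact: cvg_snd.
have cPhi : continuous (fun y : ((R * R) * R) * R => Phi y.1 y.2).
  have ck (k : R * R -> R) (h : ((R * R) * R) * R -> R) : continuous k ->
      continuous h -> continuous (fun y => at_ k (h y) y.1.1).
    move=> ck ch; apply: (@continuous_comp2 R _ k (fun y => h y * y.1.1.1)
      (fun y => h y * y.1.1.2)) => //; exact: continuous_mul.
  have c34 : continuous (fun y : ((R * R) * R) * R => y.1.2 + y.2).
    exact: continuous_add.
  rewrite /Phi; apply: continuous_add; apply: continuous_mul.
  - exact: (ck k1 (fun y => y.1.2)).
  - exact: (ck k1 (fun y => y.1.2 + y.2)).
  - exact: (ck k2 (fun y => y.1.2)).
  - exact: (ck k2 (fun y => y.1.2 + y.2)).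
have cptQ : compact (big_square `*` `[0 : R, 1]%classic).
  by apply: compact_setX; [apply: compact_setX|]; exact: segment_compact.
have /compact_near_coveringP near_cov := cptQ.
have [] := near_cov _ (nbhs (0 : R)) (fun s x => 0 < Phi x s) _ _.
  move=> x _.
  have : nbhs (x, 0 : R) [set y : ((R * R) * R) * R | 0 < Phi y.1 y.2].
    have := cPhi (x, 0) [set r : R | 0 < r]; apply.
    apply: open_nbhs_nbhs; split; first exact: open_gt.
    by rewrite /= /Phi addr0 -!expr2; exact: k_neq0.
  exact.
move=> dl /= dl0 dlP; pose n := Num.bound dl^-1.
have n_dl : n.+1%:R^-1 < dl.
  rewrite -[ltRHS]invrK ltf_pV2 ?posrE ?invr_gt0 ?ltr0n //.
  apply: (@lt_trans _ _ n%:R); last by rewrite ltr_nat.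
  by apply: archi_boundP; rewrite invr_ge0 ltW.
exists n => i z iN zQ.
have := dlP n.+1%:R^-1; rewrite /= sub0r normrN ger0_norm ?invr_ge0 ?ler0n //.
move=> /(_ n_dl (z, i%:R / n.+1%:R)); rewrite /Phi /=.
have -> : i%:R / n.+1%:R + n.+1%:R^-1 = i.+1%:R / n.+1%:R :> R.
  by rewrite -[in RHS](addn1 i) natrD mulrDl mul1r.
apply; split=> //=; rewrite in_itv /= divr_ge0 ?ler0n //=.
by rewrite ler_pdivrMr ?ltr0n // mul1r ler_nat ltnW.
Qed.

(** The value of [k] at [z] is reached from its value at the origin in finitely
    many steps along the ray to [z]; each step multiplies it, up to a positive
    factor, by a number of positive real part, and these have the continuous square
    root [|r| + r]. *)
Lemma continuous_sqrt_on_square : exists g1 g2 : R * R -> R,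
  [/\ continuous g1, continuous g2 & forall z, big_square z -> exists rho,
    [/\ 0 < rho, g1 z ^+ 2 - g2 z ^+ 2 = rho * k1 z & 2 * g1 z * g2 z = rho * k2 z]].
Proof.
have [n nP] := uniform_half_plane.
suff H i : (i <= n.+1)%N -> exists g1 g2 : R * R -> R,
    [/\ continuous g1, continuous g2 & forall z, big_square z -> exists rho,
    [/\ 0 < rho, g1 z ^+ 2 - g2 z ^+ 2 = rho * at_ k1 (i%:R / n.+1%:R) z &
        2 * g1 z * g2 z = rho * at_ k2 (i%:R / n.+1%:R) z]].
  have [g1 [g2 [cg1 cg2 gP]]] := H n.+1 (leqnn _).
  exists g1, g2; split=> // z /gP; rewrite divff ?pnatr_eq0 // /at_ !mul1r.
  by rewrite -surjective_pairing.
elim: i => [|i IH] iN.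
  have [g1 [g2 [rho gP]]] := complex_sqrt_const (k_neq0 (0, 0)).
  exists (fun=> g1), (fun=> g2); split; try exact: continuous_cst_fun.
  by move=> z _; exists rho; rewrite /at_ !mul0r.
have [g1 [g2 [cg1 cg2 gP]]] := IH (ltnW iN).
pose t : R := i%:R / n.+1%:R; pose t' : R := i.+1%:R / n.+1%:R.
pose a z := at_ k1 t z * at_ k1 t' z + at_ k2 t z * at_ k2 t' z.
pose b z := at_ k2 t' z * at_ k1 t z - at_ k1 t' z * at_ k2 t z.
pose m z := Num.sqrt (a z ^+ 2 + b z ^+ 2).
have ck1 s : continuous (at_ k1 s) by exact: at_continuous.
have ck2 s : continuous (at_ k2 s) by exact: at_continuous.
have [c1t c1t' c2t c2t'] := And4 (ck1 t) (ck1 t') (ck2 t) (ck2 t').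
have ca : continuous a by rewrite /a; cont.
have cb : continuous b by rewrite /b; cont.
have cm : continuous m.
  have csq : continuous (fun z => a z * a z + b z * b z) by cont.
  by apply: (continuous_comp1 (@sqrt_continuous R)) csq.
exists (fun z => g1 z * (m z + a z) - g2 z * b z).
exists (fun z => g1 z * b z + g2 z * (m z + a z)).
split; [by cont | by cont |] => z zQ; have [rho [rho0 E1 E2]] := gP z zQ.
have az : 0 < a z by exact: nP.
have mz : m z ^+ 2 = a z ^+ 2 + b z ^+ 2.
  by rewrite sqr_sqrtr // addr_ge0 ?sqr_ge0.
have mz0 : 0 <= m z by exact: sqrtr_ge0.
have kz : 0 < at_ k1 t z ^+ 2 + at_ k2 t z ^+ 2 by exact: k_neq0.
exists (2 * rho * (m z + a z) * (at_ k1 t z ^+ 2 + at_ k2 t z ^+ 2)); split.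
- by rewrite !mulr_gt0 // ltr_wpDl.
- transitivity ((g1 z ^+ 2 - g2 z ^+ 2) * (m z ^+ 2 + 2 * m z * a z + a z ^+ 2 - b z ^+ 2)
    - 2 * g1 z * g2 z * (2 * (m z + a z) * b z)); first by ring.
  by rewrite E1 E2 mz -/t -/t' /a /b; ring.
- transitivity ((g1 z ^+ 2 - g2 z ^+ 2) * (2 * (m z + a z) * b z)
    + 2 * g1 z * g2 z * (m z ^+ 2 + 2 * m z * a z + a z ^+ 2 - b z ^+ 2)); first by ring.
  by rewrite E1 E2 mz -/t -/t' /a /b; ring.
Qed.

(** Let [g] be the square root and [im] the imaginary part of [g (- v)] times the
    conjugate of [g v].  As [k (- v) = - k v], the square of this product is a
    negative real, so the product is imaginary and [im] does not vanish.  But [v]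
    runs along half of the boundary of the square, from a corner to the opposite
    one, and exchanging [v] and [- v] changes the sign of [im]. *)
Lemma no_odd_boundary :
  let v (t : R) := (Num.min 1 (1 - 2 * t), Num.min 1 (1 + 2 * t)) in
  ~ forall t, -1 <= t <= 1 -> k1 (- (v t).1, - (v t).2) = - k1 (v t) /\
                             k2 (- (v t).1, - (v t).2) = - k2 (v t).
Proof.
move=> v odd_k; have [g1 [g2 [cg1 cg2 gP]]] := continuous_sqrt_on_square.
pose nv t := (- (v t).1, - (v t).2).
pose im t := g2 (nv t) * g1 (v t) - g1 (nv t) * g2 (v t).
have cg (g : R * R -> R) : continuous g -> continuous (fun t => g (v t)).
  by move=> cg; apply: (@continuous_comp2 R _ g) => //; cont.
have cgn (g : R * R -> R) : continuous g -> continuous (fun t => g (nv t)).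
  by move=> cg'; apply: (@continuous_comp2 R _ g) => //=; cont.
have cim : continuous im.
  have [h1 h2 h3 h4] := And4 (cg _ cg1) (cg _ cg2) (cgn _ cg1) (cgn _ cg2).
  by rewrite /im; cont.
have vQ t : -1 <= t <= 1 -> big_square (v t).
  move=> /andP[t0 t1]; split; rewrite /= in_itv /= le_min ge_min; lra.
have nvQ t : -1 <= t <= 1 -> big_square (nv t).
  by move=> /vQ[/segmentP h1 /segmentP h2]; split; apply/segmentP; rewrite /nv; move: h1 h2 => /=; lra.
have im_neq0 t : -1 <= t <= 1 -> im t <> 0.
  move=> tI im0; have [E1 E2] := odd_k t tI.
  have [r [r0 Ea1 Ea2]] := gP _ (vQ t tI).
  have [r' [r'0 Eb1 Eb2]] := gP _ (nvQ t tI).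
  rewrite E1 in Eb1; rewrite E2 in Eb2.
  pose re := g1 (nv t) * g1 (v t) + g2 (nv t) * g2 (v t).
  have : re ^+ 2 - im t ^+ 2 = - (r * r' * (k1 (v t) ^+ 2 + k2 (v t) ^+ 2)).
    transitivity ((g1 (nv t) ^+ 2 - g2 (nv t) ^+ 2) * (g1 (v t) ^+ 2 - g2 (v t) ^+ 2)
      + (2 * g1 (nv t) * g2 (nv t)) * (2 * g1 (v t) * g2 (v t))).
      by rewrite /re /im; ring.
    by rewrite Ea1 Ea2 Eb1 Eb2; ring.
  have : 0 < r * r' * (k1 (v t) ^+ 2 + k2 (v t) ^+ 2) by rewrite !mulr_gt0.
  by rewrite im0 expr0n subr0; have := sqr_ge0 re; lra.
have im_anti : im 1 = - im (-1).
  have -> : im 1 = g2 (nv 1) * g1 (v 1) - g1 (nv 1) * g2 (v 1) by [].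
  have vp : v 1 = (-1, 1).
    by rewrite /v; congr (_, _); [rewrite min_r | rewrite min_l]; lra.
  have vm : v (-1) = (1, -1).
    by rewrite /v; congr (_, _); [rewrite min_l | rewrite min_r]; lra.
  have v1 : v 1 = nv (-1) by rewrite /nv vm /= opprK vp.
  have nv1 : nv 1 = v (-1) by rewrite /nv vp /= opprK vm.
  by rewrite v1 nv1 /im; ring.
have [h|h] := leP (im 1) 0.
  have [|c] := @intermediate_value R im 1 (-1) 0 cim; first by lra.
  rewrite min_r ?max_l; [|lra..] => cI; exact: im_neq0.
have [|c] := @intermediate_value R im (-1) 1 0 cim; first by lra.
rewrite min_l ?max_r; [|lra..] => cI; exact: im_neq0.
Qed.

End SquareRoots.

(** * Invariance of dimension *)

Section Dimension.
Variable R : realType.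

(** The [j]-th coordinate, and 0 beyond the last one, so that vectors of length at
    most two can be treated as vectors of length two. *)
Definition coord0 m (w : 'rV[R]_m) (j : nat) : R :=
  oapp (fun i => w ord0 i) 0 (insub j : option 'I_m).

Lemma coord0_continuous m j : continuous (fun w : 'rV[R]_m => coord0 w j).
Proof.
rewrite /coord0; case: insub => [i|] /=; last exact: continuous_cst_fun.
exact: coord_continuous.
Qed.

Lemma coord0_inj m (w w' : 'rV[R]_m) : (m <= 2)%N ->
  coord0 w 0 = coord0 w' 0 -> coord0 w 1 = coord0 w' 1 -> w = w'.
Proof.
move=> m2 E0 E1; apply/rowP => i.
have wE (u : 'rV[R]_m) : u ord0 i = coord0 u i by rewrite /coord0 valK.
rewrite !wE; have : (i < 2)%N by exact: leq_trans (ltn_ord i) m2.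
by case: (nat_of_ord i) => [|[|]].
Qed.

(** The points [pt 1 z] and [pt (-1) z] are opposite points of a 2-sphere around
    [p]: the third coordinate [ht] is 1 at the origin and vanishes on the boundary
    of the square. *)
Lemma no_embedding_in_plane n m (O : set 'rV[R]_n) (h : 'rV[R]_n -> 'rV[R]_m) :
  (2 < n)%N -> (m <= 2)%N -> open O -> O !=set0 -> {within O, continuous h} ->
  (forall v w, O v -> O w -> h v = h w -> v = w) -> False.
Proof.
move=> n2 m2 openO [p Op] ch inj_h.
have /nbhs_ballP[r /= r0 rO] : nbhs p O by exact: open_nbhs_nbhs.
pose cl (x : R) : R := clamp x.
pose ht (z : R * R) := (1 - cl z.1 * cl z.1) * (1 - cl z.2 * cl z.2).
pose comp (i : nat) (z : R * R) : R :=
  if i == 0%N then cl z.1 else if i == 1%N then cl z.2 else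
  if i == 2%N then ht z else 0.
pose pt (sg : R) (z : R * R) : 'rV[R]_n :=
  \row_i (p ord0 i + sg * (r / 2 * comp i z)).
have ccomp i : continuous (comp i).
  by rewrite /comp /ht /cl /clamp; case: eqP => _; [|case: eqP => _; [|case: eqP => _]];
    cont.
have comp1 i z : -1 <= comp i z <= 1.
  rewrite /comp /ht /cl; have := clamp_in z.1; have := clamp_in z.2.
  case: eqP => _ //; case: eqP => _ //; case: eqP => _ z2 z1; last by lra.
  have sq01 (a : R) : -1 <= a <= 1 -> 0 <= 1 - a * a <= 1.
    by move=> /andP[a0 a1]; have := sqr_ge0 a; rewrite expr2 => ?; apply/andP; split; nra.
  have [/andP[a0 a1] /andP[b0 b1]] := (sq01 _ z1, sq01 _ z2).
  have := mulr_ge0 a0 b0; have := mulr_ile1 a0 b0 a1 b1; lra.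
have ptO sg z : sg = 1 \/ sg = -1 -> O (pt sg z).
  move=> sgE; apply: rO; split=> // i j; rewrite (ord1 i) mxE /ball /=.
  rewrite opprD addrA subrr sub0r normrN.
  have -> : `|sg * (r / 2 * comp j z)| = `|sg| * (`|r / 2| * `|comp j z|).
    by rewrite !normrM.
  have -> : `|sg| = 1 by case: sgE => ->; rewrite ?normrN normr1.
  rewrite mul1r gtr0_norm ?divr_gt0 //.
  have : `|comp j z| <= 1 by rewrite ler_norml comp1.
  move=> comp_le1; apply: (@le_lt_trans _ _ (r / 2 * 1)); last by lra.
  by rewrite ler_wpM2l // ltW // divr_gt0.
have chpt sg j : sg = 1 \/ sg = -1 -> continuous (fun z => coord0 (h (pt sg z)) j).
  move=> sgE z.
  have cpt : continuous (pt sg).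
    apply: continuous_rV => i.
    have -> : (fun z => pt sg z ord0 i) = (fun z => p ord0 i + sg * (r / 2 * comp i z)).
      by apply/funext => z'; rewrite mxE.
    by have ci := ccomp i; cont.
  have chz : {for pt sg z, continuous h}.
    move: ch; rewrite continuous_open_subspace // => /(_ (pt sg z)); apply.
    by apply/mem_set; exact: ptO.
  have c1 := cvg_comp _ _ (cpt z) chz.
  exact: (cvg_comp _ _ c1 (@coord0_continuous m j _)).
have [pl mi] : ((1 : R) = 1 \/ (1 : R) = -1) * ((-1 : R) = 1 \/ (-1 : R) = -1).
  by split; [left | right].
pose k j z := coord0 (h (pt 1 z)) j - coord0 (h (pt (-1) z)) j.
have ck j : continuous (k j).
  apply: continuous_add; first exact: chpt.
  by apply: continuous_opp; exact: chpt.
have k_neq0 z : 0 < k 0%N z ^+ 2 + k 1%N z ^+ 2.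
  rewrite lt_neqAle eq_sym addr_ge0 ?sqr_ge0 // andbT.
  rewrite paddr_eq0 ?sqr_ge0 // !sqrf_eq0 /k !subr_eq0.
  apply/negP => /andP[/eqP E0 /eqP E1].
  have /inj_h := coord0_inj m2 E0 E1.
  move=> /(_ (ptO _ _ pl) (ptO _ _ mi)) E.
  have comp0 i : (i < n)%N -> comp i z = 0.
    move=> iN; have := congr1 (fun v : 'rV[R]_n => v ord0 (Ordinal iN)) E.
    rewrite !mxE /= mul1r mulN1r => /addrI E'.
    have : r / 2 * comp i z = 0 by lra.
    by move=> /eqP; rewrite mulf_eq0 gt_eqF ?divr_gt0 //= => /eqP.
  have := comp0 0%N (ltn_trans _ n2); have := comp0 1%N (ltn_trans _ n2).
  have := comp0 2%N n2; rewrite /comp /= /ht => h2 /(_ isT) h1 /(_ isT) h0.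
  by move: h2; rewrite h1 h0; lra.
have odd_bd (a b : R) : -1 <= a <= 1 -> -1 <= b <= 1 -> a = 1 \/ b = 1 ->
    k 0%N (- a, - b) = - k 0%N (a, b) /\ k 1%N (- a, - b) = - k 1%N (a, b).
  move=> aI bI bd.
  have naI : -1 <= - a <= 1 by lra.
  have nbI : -1 <= - b <= 1 by lra.
  have ptN sg : pt sg (- a, - b) = pt (- sg) (a, b).
    apply/rowP => i; rewrite !mxE; congr (_ + _).
    rewrite mulNr -mulrN -mulrN; congr (_ * (_ * _)).
    rewrite /comp /ht /cl /= !clampE //.
    case: eqP => // _; case: eqP => // _; case: eqP => // _; last by rewrite oppr0.
    by case: bd => ->; ring.
  by rewrite /k !ptN opprK; split; ring.
apply: (no_odd_boundary (ck 0%N) (ck 1%N) k_neq0) => t tI; apply: odd_bd => /=.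
- by rewrite le_min ge_min; lra.
- by rewrite le_min ge_min; lra.
- by have [t0|t0] := leP t 0; [left|right]; rewrite min_l //; lra.
Qed.

(** If the first closed set does not contain all of [O], the part of [O] outside
    it is open and covered by the other ones. *)
Lemma finite_closed_cover_interior (T : topologicalType) (I : eqType) (s : seq I)
    (D : I -> set T) (O : set T) :
  open O -> O !=set0 -> (forall i, closed (D i)) ->
  (forall x, O x -> exists2 i, i \in s & D i x) ->
  exists i W, [/\ open W, W !=set0, W `<=` O & W `<=` D i].
Proof.
move=> oO O0 cD; elim: s O oO O0 => [|i s IH] O oO O0 cover.
  by have [x Ox] := O0; have [] := cover x Ox.
have [sub|nsub] := pselect (O `<=` D i); first by exists i, O; split.
have [||x [Ox nDx] | j [W [oW W0 W_O W_D]]] := IH (O `&` ~` D i).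
- by apply: openI => //; exact: closed_openC.
- apply: contrapT => none; apply: nsub => x Ox; apply: contrapT => nDx.
  by apply: none; exists x.
- have [j] := cover x Ox; rewrite inE => /orP[/eqP -> //|js Dj].
  by exists j.
- by exists j, W; split=> // x /W_O[].
Qed.

Variable X : topologicalType.

Lemma closed_cell_compact (K : regular_cw R X) (c : K) : compact (closed_cell c).
Proof.
apply: continuous_compact; last exact: compact_closed_disc.
by have [] := char_map_embedding c.
Qed.

Lemma closed_cell_closed (K : regular_cw R X) (c : K) : closed (closed_cell c).
Proof.
apply: compact_closed; first exact: cw_hausdorff K.
exact: closed_cell_compact.
Qed.

Lemma open_cell_sub (K : regular_cw R X) (c : K) : open_cell c `<=` closed_cell c.
Proof. by move=> x [w w1 <-]; exists w => //; exact: ltW. Qed.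

Lemma char_map_inj (K : regular_cw R X) (c : K) w w' :
  closed_disc R _ w -> closed_disc R _ w' ->
  char_map (c := c) w = char_map (c := c) w' -> w = w'.
Proof.
have [_ inj_c _] := char_map_embedding c => w1 w'1 E.
by apply: (inj_c w w') => //; exact/mem_set.
Qed.

Lemma cell_continuous (K : regular_cw R X) (c : K) (U : topologicalType)
    (g : 'rV[R]_(cell_dim c) -> U) (f : X -> U) :
  {within closed_disc R (cell_dim c), continuous g} ->
  (forall w, closed_disc R _ w -> f (char_map (c := c) w) = g w) ->
  {within closed_cell c, continuous f}.
Proof.
have [cc _ _] := char_map_embedding c => cg fg.
rewrite /closed_cell; apply: (factor_continuous (cw_hausdorff K) _ cc cg fg).
exact: compact_closed_disc.
Qed.

Lemma cell_inverse (K : regular_cw R X) (c : K) :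
  exists hinv : X -> 'rV[R]_(cell_dim c), {within closed_cell c, continuous hinv} /\
    forall w, closed_disc R _ w -> hinv (char_map (c := c) w) = w.
Proof.
have [cc _ _] := char_map_embedding c.
exact: (@embedding_inverse 'rV[R]_(cell_dim c) X _ _ 0 (cw_hausdorff K)
  (@compact_closed_disc R _) cc
  (@char_map_inj K c)).
Qed.

(** The open cell is covered by the finitely many closed cells of a complex of
    dimension two; one of them contains an open part of it, which thus embeds in a
    disc of dimension at most two. *)
Lemma cell_dim_le2 (K : regular_cw R X) (c : K) :
  polyhedron_of_dim R 2 X -> (cell_dim c <= 2)%N.
Proof.
move=> [K' [dimK' _]]; rewrite leqNgt; apply/negP => c3.
have [cc _ _] := char_map_embedding c.
pose D (d : K') := closed_disc R (cell_dim c) `&` char_map (c := c) @^-1` closed_cell d.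
have cD d : closed (D d).
  have [V cV VA] : exists2 V, closed V & V `&` closed_disc R (cell_dim c) =
      char_map (c := c) @^-1` closed_cell d `&` closed_disc R (cell_dim c).
    apply/closed_subspaceP; move/continuous_closedP : cc; apply.
    exact: closed_cell_closed.
  rewrite /D setIC -VA; apply: closedI => //; apply: compact_closed.
    exact: norm_hausdorff.
  exact: compact_closed_disc.
have [||x x1 | d [W [oO O0 Osub OD]]] :=
    @finite_closed_cover_interior _ K' (enum K') D (open_disc R (cell_dim c)) _ _ cD.
- apply: (@open_comp _ _ (fun w : 'rV[R]_(cell_dim c) => sqnorm w) [set t | t < 1]).
    by move=> x _; exact: continuous_sqnorm.
  exact: open_lt.
- by exists 0; rewrite /open_disc /= -(scale0r 0) sqnormZ expr0n mul0r ltr01.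
- have [d dx] := open_cells_cover K' (char_map (c := c) x).
  exists d; first by rewrite mem_enum.
  by split; [exact: ltW | exact: open_cell_sub].
have [hinv [chinv hE]] := cell_inverse d.
apply: (@no_embedding_in_plane _ _ W (fun w => hinv (char_map (c := c) w)) c3 (dimK' d) oO O0).
  apply: (@comp_within_continuous _ _ _ W (closed_cell d) (char_map (c := c)) hinv) => //.
    by apply: continuous_subspaceW cc => x /Osub; exact: ltW.
  by move=> x /OD[].
move=> v w Ov Ow E.
have [v1 [v' v'1 v'E]] := OD _ Ov; have [w1 [w' w'1 w'E]] := OD _ Ow.
apply: (char_map_inj v1 w1); rewrite -v'E -w'E; congr char_map.
by move: E; rewrite -v'E -w'E !hE.
Qed.

End Dimension.

(** * Free faces *)

Section FreeArc.
Variable R : realType.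

Lemma sqnorm1 (u : R) : sqnorm (const_mx u : 'rV[R]_1) = u ^+ 2.
Proof. by rewrite /sqnorm big_ord_recl big_ord0 addr0 mxE. Qed.

Lemma rV1E (w : 'rV[R]_1) : w = const_mx (w ord0 ord0).
Proof. by apply/rowP => i; rewrite mxE (ord1 i). Qed.

Lemma le1_sqr (u : R) : (u ^+ 2 <= 1) = (-1 <= u <= 1).
Proof. by rewrite -ler_norml -[X in _ <= X](expr1n _ 2) -real_normK ?num_real // ler_pXn2r // nnegrE. Qed.

Lemma lt1_sqr (u : R) : (u ^+ 2 < 1) = (-1 < u < 1).
Proof. by rewrite -ltr_norml -[X in _ < X](expr1n _ 2) -real_normK ?num_real // ltr_pXn2r // nnegrE. Qed.

(** [tau] is the affine parameter of the interval, running from [- w0] to [w0].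
    The dimension is only equal to 1 propositionally, since it will be the dimension
    of a cell. *)
Lemma interval_coordinate n (w0 : 'rV[R]_n) : n = 1%N -> unit_sphere R n w0 ->
  exists tau : 'rV[R]_n -> R, [/\ continuous tau,
    forall w w', tau w = tau w' -> w = w',
    forall w, closed_disc R n w -> 0 <= tau w <= 1,
    tau (- w0) = 0 /\ tau w0 = 1 &
    forall w, unit_sphere R n w -> w = w0 \/ w = - w0].
Proof.
move=> n1; move: w0; rewrite n1 => w0 {n n1}.
rewrite (rV1E w0) /unit_sphere /= sqnorm1; set a := w0 ord0 ord0 => a2.
have a_neq0 : a != 0 by rewrite -sqrf_eq0 a2 oner_eq0.
exists (fun w : 'rV[R]_1 => (1 + a * w ord0 ord0) / 2); split.
- have c := @coord_continuous R 1 1 ord0 ord0.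
  by cont.
- move=> w w' E; rewrite (rV1E w) (rV1E w'); congr const_mx.
  by apply: (mulfI a_neq0); lra.
- move=> w; rewrite {1}(rV1E w) /closed_disc /= sqnorm1 le1_sqr => wI.
  have aI : -1 <= a <= 1 by rewrite -le1_sqr a2.
  have : (a * w ord0 ord0) ^+ 2 <= 1 by rewrite exprMn a2 mul1r le1_sqr.
  by rewrite le1_sqr; lra.
- by rewrite !mxE mulrN -expr2 a2; split; lra.
- move=> w; rewrite {1 2 3}(rV1E w) sqnorm1 -a2 => /eqP.
  rewrite eqf_sqr => /orP[/eqP->|/eqP->]; [by left|right].
  by apply/rowP => i; rewrite !mxE.
Qed.

(** [be] is the arc of the boundary of the disc complementary to the free edge. *)
Lemma free_arc (X : topologicalType) n m (chs : 'rV[R]_n -> X) (cht : 'rV[R]_m -> X) :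
  n = 2%N -> m = 1%N -> hausdorff_space X ->
  embedding_on (closed_disc R n) chs -> embedding_on (closed_disc R m) cht ->
  cht @` closed_disc R m `<=` chs @` unit_sphere R n ->
  exists (be : R -> 'rV[R]_n) (q : 'rV[R]_n -> R * R),
  [/\ {within `[0, 1], continuous be},
      forall s t, 0 <= s <= 1 -> 0 <= t <= 1 -> be s = be t -> s = t,
      forall s, 0 <= s <= 1 -> [/\ unit_sphere R n (be s), q (be s) = (s, 0) &
        ~ (cht @` open_disc R m) (chs (be s))],
      (cht @` unit_sphere R m) (chs (be 0)) /\ (cht @` unit_sphere R m) (chs (be 1)) &
  [/\ {within closed_disc R n, continuous (fun z => (q z).1)},
      {within closed_disc R n, continuous (fun z => (q z).2)},
      (forall z, closed_disc R n z -> unit_square (q z)) /\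
      (forall z z', closed_disc R n z -> closed_disc R n z' -> q z = q z' -> z = z'),
      forall w, unit_sphere R n w -> (cht @` open_disc R m) (chs w) ->
        open_sides (q w) &
      forall w, unit_sphere R n w -> ~ (cht @` open_disc R m) (chs w) ->
        exists2 s, 0 <= s <= 1 & w = be s]].
Proof.
move=> n2 m1; move: chs cht; rewrite n2 m1 {n m n2 m1} => chs cht hX [cs inj_s _] [ct inj_t _] sub.
have chs_inj w w' : closed_disc R 2 w -> closed_disc R 2 w' -> chs w = chs w' -> w = w'.
  by move=> h h' E; apply: (inj_s w w') => //; exact/mem_set.
have cht_inj w w' : closed_disc R 1 w -> closed_disc R 1 w' -> cht w = cht w' -> w = w'.
  by move=> h h' E; apply: (inj_t w w') => //; exact/mem_set.
have sphere_disc w : unit_sphere R 2 w -> closed_disc R 2 w.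
  by rewrite /unit_sphere /closed_disc /= => ->.
have disc1 u : -1 <= u <= 1 -> closed_disc R 1 (const_mx u).
  by move=> uI; rewrite /closed_disc /= sqnorm1 le1_sqr.
have [ph phP] : {ph : R -> 'rV[R]_2 & forall u, -1 <= u <= 1 ->
    unit_sphere R 2 (ph u) /\ chs (ph u) = cht (const_mx u)}.
  apply: (@choice _ _ (fun u w => -1 <= u <= 1 ->
    unit_sphere R 2 w /\ chs w = cht (const_mx u))) => u.
  have [uI|nuI] := pselect (-1 <= u <= 1); last by exists 0.
  have [w w1 wE] : (chs @` unit_sphere R 2) (cht (const_mx u)).
    by apply: sub; exists (const_mx u) => //; exact: disc1.
  by exists w.
have cph : {within `[-1, 1], continuous ph}.
  have [hinv [chinv hE]] : exists hinv : X -> 'rV[R]_2,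
      {within chs @` closed_disc R 2, continuous hinv} /\
      forall w, closed_disc R 2 w -> hinv (chs w) = w.
    exact: (@embedding_inverse 'rV[R]_2 X _ _ 0 hX (@compact_closed_disc R 2) cs chs_inj).
  have ccht : {within `[-1, 1], continuous (fun u => cht (const_mx u))}.
    apply: (@comp_within_continuous _ _ _ _ (closed_disc R 1) (fun u => const_mx u) cht _ ct).
      apply: continuous_subspaceT; apply: continuous_rV => i.
      have -> : (fun u : R => (const_mx u : 'rV[R]_1) ord0 i) = (fun u => u).
        by apply/funext => u; rewrite mxE.
      exact: continuous_id_fun.
    by move=> u /segmentP; exact: disc1.
  have c : {within `[-1, 1], continuous (fun u => hinv (cht (const_mx u)))}.
    apply: (@comp_within_continuous _ _ _ _ (chs @` closed_disc R 2) _ hinv ccht chinv).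
    move=> u /segmentP uI; have [w1 wE] := phP u uI.
    by exists (ph u); [exact: sphere_disc | exact: wE].
  apply: (subspace_eq_continuous _ c) => u /set_mem /segmentP uI.
  have [w1 wE] := phP u uI.
  have E : hinv (cht (const_mx u)) = ph u by rewrite -wE hE //; exact: sphere_disc.
  exact: E.
have ph_inj u v : -1 <= u <= 1 -> -1 <= v <= 1 -> ph u = ph v -> u = v.
  move=> uI vI E; have [_ Eu] := phP u uI; have [_ Ev] := phP v vI.
  have /(cht_inj _ _ (disc1 _ uI) (disc1 _ vI)) : cht (const_mx u) = cht (const_mx v).
    by rewrite -Eu -Ev E.
  by move=> /rowP/(_ ord0); rewrite !mxE.
have ph_sphere u : -1 <= u <= 1 -> unit_sphere R 2 (ph u) by case/phP.
have [be loop] := arc_complement cph ph_sphere ph_inj.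
have [q [cq1 cq2 qsq q_be q_ph]] := disc_to_square loop.
case: loop => cbe _ be_sphere _ be_inj _ be0 be1 meet cover.
have open_ph w : unit_sphere R 2 w -> (cht @` open_disc R 1) (chs w) ->
    exists2 u, -1 < u < 1 & w = ph u.
  move=> w1 [z]; rewrite (rV1E z) /open_disc /= sqnorm1 lt1_sqr; set u := z ord0 ord0.
  move=> uI E; have uI' : -1 <= u <= 1 by lra.
  exists u => //; have [p1 pE] := phP u uI'; apply: chs_inj; rewrite ?pE //; exact: sphere_disc.
have I0 : 0 <= (0 : R) <= 1 by lra.
have I1 : 0 <= (1 : R) <= 1 by lra.
have J0 : -1 <= (-1 : R) <= 1 by lra.
have J1 : -1 <= (1 : R) <= 1 by lra.
exists be, q; split=> //.
- move=> s sI; split; [exact: be_sphere | exact: q_be |].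
  move=> /(open_ph _ (be_sphere _ sI))[u uI E].
  have uI' : -1 <= u <= 1 by lra.
  by case: (meet _ _ sI uI' E) => -[_ uE]; move: uI; rewrite uE ltxx ?andbF.
- rewrite be0 be1; split; [exists (const_mx (-1)) | exists (const_mx 1)].
  + by rewrite /unit_sphere /= sqnorm1; ring.
  + by have [_ ->] := phP _ J0.
  + by rewrite /unit_sphere /= sqnorm1; ring.
  + by have [_ ->] := phP _ J1.
- split=> //.
    by move=> w w1 /(open_ph _ w1)[u uI ->]; apply: q_ph; lra.
  move=> w w1 nopen; case: (cover w w1) => // -[u uI E].
  have [u_1|uN1] := eqVneq u (-1).
    by exists 0 => //; rewrite E u_1 be0.
  have [u_1|uN1'] := eqVneq u 1.
    by exists 1 => //; rewrite E u_1 be1.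
  case: nopen; exists (const_mx u); last by rewrite E; have [_ ->] := phP _ uI.
  rewrite /open_disc /= sqnorm1 lt1_sqr; case/andP: uI => u0 u1.
  by rewrite !lt_neqAle eq_sym uN1 u0 uN1' u1.
Qed.

End FreeArc.

(** * Maps adapted to a subcomplex *)

Section Expansions.
Variables (R : realType) (X : topologicalType) (K : regular_cw R X).
Local Notation pt := (bool -> nat -> R).
Implicit Types (A B : {set K}) (c d s t : K).

Definition carrier A : set X := \bigcup_(d in [set d : K | d \in A]) open_cell d.

Lemma carrierE A : subcomplex A ->
  carrier A = \bigcup_(d in [set d : K | d \in A]) closed_cell d.
Proof.
move=> subA; apply/seteqP; split=> x [d dA]; last exact: (subA d dA).
by move=> /open_cell_sub xd; exists d.
Qed.

Lemma carrier_closed A : subcomplex A -> closed (carrier A).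
Proof.
move=> /carrierE ->; apply: closed_bigcup; first exact: finite_finset.
by move=> d _; exact: closed_cell_closed.
Qed.

Lemma disc_open_or_sphere n (w : 'rV[R]_n) : closed_disc R n w ->
  open_disc R n w \/ unit_sphere R n w.
Proof.
by rewrite /closed_disc /open_disc /unit_sphere /= le_eqVlt => /orP[/eqP|]; auto.
Qed.

Lemma sphere_not_open_cell c w : unit_sphere R _ w ->
  ~ open_cell c (char_map (c := c) w).
Proof.
move=> w1 wo; have [d /= dc dw] := cell_boundary (imageP (char_map (c := c)) w1).
by have := open_cells_disjoint wo dw => E; move: dc; rewrite -E ltnn.
Qed.

(** The embeddings of subcomplexes that are built along the collapse. *)
Record adapted (A : {set K}) (N : nat) (f : X -> pt) : Prop := Adapted {
  adapted_continuous : forall e j, {within carrier A, continuous (fun x => f x e j)};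
  adapted_subtree : forall x, carrier A x -> subtree2 N (f x);
  adapted_inj : forall x y, carrier A x -> carrier A y -> f x = f y -> x = y;
  adapted_grid : forall c x, c \in A -> (cell_dim c <= 1)%N -> open_cell c x ->
    grid (f x);
  adapted_node : forall c x, c \in A -> cell_dim c = 0%N -> open_cell c x ->
    node (f x)
}.

Lemma adapted_grid_below A N f c x : adapted A N f -> carrier A x ->
  (cell_dim c <= 1)%N -> open_cell c x -> grid (f x).
Proof.
move=> gf [d dA xd] c1 xc; have E := open_cells_disjoint xd xc.
by apply: (adapted_grid gf dA) => //; rewrite E.
Qed.

Lemma adapted_node_below A N f c x : adapted A N f -> carrier A x ->
  cell_dim c = 0%N -> open_cell c x -> node (f x).
Proof.
move=> gf [d dA xd] c1 xc; have E := open_cells_disjoint xd xc.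
by apply: (adapted_node gf dA) => //; rewrite E.
Qed.

Section OneCollapse.
Variables (A B : {set K}) (s t : K).
Hypotheses (subA : subcomplex A) (subB : subcomplex B).
Hypotheses (sA : s \in A) (face_ts : face t s).
Hypothesis dim_s : cell_dim s = (cell_dim t).+1.
Hypothesis BE : B = (A :\: [set s; t])%SET.

Lemma carrierB_not_open x : carrier B x -> ~ open_cell s x /\ ~ open_cell t x.
Proof.
move=> [d /=]; rewrite BE !inE negb_or => /andP[/andP[ds dt] _] xd; split=> xo.
  by move: ds; rewrite (open_cells_disjoint xd xo) eqxx.
by move: dt; rewrite (open_cells_disjoint xd xo) eqxx.
Qed.

Lemma carrierA_cases x : carrier A x ->
  [\/ open_cell s x, open_cell t x | carrier B x].
Proof.
move=> [d /= dA xd]; have [ds|ds] := eqVneq d s.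
  by apply: Or31; rewrite -ds.
have [dt|dt] := eqVneq d t; first by apply: Or32; rewrite -dt.
by apply: Or33; exists d; rewrite //= BE !inE negb_or ds dt.
Qed.

Lemma closed_s_carrierA : closed_cell s `<=` carrier A.
Proof. exact: subA. Qed.

Lemma carrier_split : carrier A = carrier B `|` closed_cell s.
Proof.
apply/seteqP; split=> x.
  case/carrierA_cases => [/open_cell_sub xs|/open_cell_sub xt|xB].
  - by right.
  - by right; exact: face_ts.
  - by left.
move=> [[d /=]|/closed_s_carrierA //]; rewrite BE !inE => /andP[_ dA] xd.
by exists d.
Qed.

Lemma sphere_s_cases w : unit_sphere R _ w ->
  open_cell t (char_map (c := s) w) \/ carrier B (char_map (c := s) w).
Proof.
move=> w1; have ws : closed_cell s (char_map (c := s) w).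
  by exists w => //; rewrite /closed_disc /= w1.
by case: (carrierA_cases (closed_s_carrierA ws)) => [/(sphere_not_open_cell w1)//||]; auto.
Qed.

Lemma open_t_sphere w : closed_disc R _ w -> open_cell t (char_map (c := s) w) ->
  unit_sphere R _ w.
Proof.
move=> /disc_open_or_sphere[wo wt|//].
have := open_cells_disjoint wt (imageP (char_map (c := s)) wo) => E.
by move: dim_s; rewrite E => /n_Sn.
Qed.

Lemma carrierB_sphere w : closed_disc R _ w -> carrier B (char_map (c := s) w) ->
  unit_sphere R _ w.
Proof.
move=> /disc_open_or_sphere[wo|//] /carrierB_not_open[] [].
exact: (imageP (char_map (c := s)) wo).
Qed.

(** A point of the closed free face is in a cell of dimension smaller than that of
    [s], hence not in the open cell [s]. *)
Lemma closed_t_sphere : closed_cell t `<=` char_map (c := s) @` unit_sphere R _.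
Proof.
move=> x xt; have [w w1 wx] := face_ts xt; exists w => //.
have [wo|//] := disc_open_or_sphere w1; exfalso.
have xs : open_cell s x by rewrite -wx; exact: (imageP (char_map (c := s)) wo).
move: xt => [u /disc_open_or_sphere[uo|u1] ux].
  have xt : open_cell t x by rewrite -ux; exact: (imageP (char_map (c := t)) uo).
  by move: dim_s; rewrite (open_cells_disjoint xs xt) => /n_Sn.
have [d /= dt dx] := cell_boundary (imageP (char_map (c := t)) u1).
by have := open_cells_disjoint xs; rewrite -ux => /(_ d dx) E; move: dt;
   rewrite -E dim_s ltnNge leqnSn.
Qed.

Lemma sphere_t_cases u : unit_sphere R _ u -> carrier B (char_map (c := t) u) /\
  exists d, (cell_dim d < cell_dim t)%N /\ open_cell d (char_map (c := t) u).
Proof.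
move=> u1; have xt : closed_cell t (char_map (c := t) u).
  by exists u => //; rewrite /closed_disc /= u1.
have [d /= dt dx] := cell_boundary (imageP (char_map (c := t)) u1).
split; last by exists d.
case: (carrierA_cases (closed_s_carrierA (face_ts xt))) => [xs|xo|//].
  have := open_cells_disjoint xs dx => E; move: dt.
  by rewrite -E dim_s ltnNge leqnSn.
by case: (sphere_not_open_cell u1 xo).
Qed.

(** Gluing of a map [f] given on the smaller complex with a map [G] given on the
    cell [s] through its parametrisation.  Injectivity across the two pieces holds
    because [G] leaves the old trees where it leaves the smaller complex. *)
Lemma extend_over_cell N f N' (G : 'rV[R]_(cell_dim s) -> pt) :
  adapted B N f -> (N <= N')%N ->
  (forall e j, {within closed_disc R (cell_dim s), continuous (fun w => G w e j)}) ->
  (forall w, closed_disc R _ w -> subtree2 N' (G w)) ->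
  (forall w w', closed_disc R _ w -> closed_disc R _ w' -> G w = G w' -> w = w') ->
  (forall w, closed_disc R _ w -> carrier B (char_map (c := s) w) ->
    G w = f (char_map (c := s) w)) ->
  (forall w, closed_disc R _ w -> ~ carrier B (char_map (c := s) w) ->
    exists e j, (N <= j)%N /\ G w e j != 0) ->
  (forall w, open_disc R _ w -> (cell_dim s <= 1)%N -> grid (G w)) ->
  (forall w, unit_sphere R _ w -> open_cell t (char_map (c := s) w) ->
    (cell_dim t <= 1)%N -> grid (G w)) ->
  (forall w, unit_sphere R _ w -> open_cell t (char_map (c := s) w) ->
    cell_dim t = 0%N -> node (G w)) ->
  exists f', adapted A N' f'.
Proof.
move=> gf NN' cG GN' inj_G Gf Goff Gs Gt Gt0.
(* The two requirements are compatible where the pieces overlap. *)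
pose P x p := (carrier B x -> p = f x) /\
  (forall w, closed_disc R (cell_dim s) w -> x = char_map (c := s) w -> p = G w).
have [f' f'P] : {f' : X -> pt & forall x, P x (f' x)}.
  apply: choice => x.
  have [[w w1 xw]|no] := pselect (exists2 w, closed_disc R _ w & x = char_map (c := s) w).
    exists (G w); split=> [xB|w' w'1].
      by rewrite xw -Gf // -xw.
    by rewrite xw => E; rewrite (char_map_inj w1 w'1 E).
  by exists (f x); split=> // w w1 xw; case: no; exists w.
have f'B x : carrier B x -> f' x = f x by case: (f'P x).
have f's w : closed_disc R _ w -> f' (char_map (c := s) w) = G w.
  by move=> w1; apply: (f'P _).2.
have AE := carrier_split.
exists f'; split.
- move=> e j; rewrite AE; apply: withinU_continuous.
  + exact: carrier_closed.
  + exact: closed_cell_closed.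
  + apply: (subspace_eq_continuous _ (@adapted_continuous _ _ _ gf e j)) => x /set_mem xB.
    have E : f' x = f x by exact: f'B.
    exact: (congr1 (fun p : pt => p e j) (esym E)).
  + apply: (cell_continuous (g := fun w => G w e j)) => // w w1.
    by rewrite f's.
- move=> x; rewrite AE => -[xB|[w w1 <-]].
    by rewrite f'B //; apply: subtree2W NN' _; exact: (adapted_subtree gf).
  by rewrite f's //; exact: GN'.
- have mixed x w : carrier B x -> closed_disc R _ w -> f' x = f' (char_map (c := s) w) ->
      x = char_map (c := s) w.
    move=> xB w1; rewrite f'B // f's // => E.
    have [wB|nwB] := pselect (carrier B (char_map (c := s) w)).
      by apply: (adapted_inj gf) => //; rewrite E Gf.
    have [e [j [Nj]]] := Goff w w1 nwB.
    by rewrite -E (subtree2_ge _ (adapted_subtree gf xB)) // eqxx.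
  move=> x y; rewrite AE => -[xB|[w w1 <-]] [yB|[w' w'1 <-]].
  + by rewrite !f'B //; exact: (adapted_inj gf).
  + exact: mixed.
  + by move=> /esym E; apply/esym; exact: mixed.
  + by rewrite !f's // => /inj_G ->.
- move=> c x cA c1 xc; have [E|cs] := eqVneq c s.
    move: c1 xc; rewrite E => s1 [w w1 <-]; rewrite f's; last exact: ltW.
    exact: Gs.
  have [E|ct] := eqVneq c t.
    move: c1 xc; rewrite E => t1 xt.
    have [w w1 wx] := face_ts (open_cell_sub xt).
    rewrite -wx f's //; apply: Gt => //; last by rewrite wx.
    by apply: open_t_sphere => //; rewrite wx.
  have cB : c \in B by rewrite BE !inE negb_or cs ct.
  by rewrite f'B; [apply: (adapted_grid gf cB) | exists c].
- move=> c x cA c0 xc; have [E|cs] := eqVneq c s.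
    by move: c0; rewrite E dim_s.
  have [E|ct] := eqVneq c t.
    move: c0 xc; rewrite E => t0 xt.
    have [w w1 wx] := face_ts (open_cell_sub xt).
    rewrite -wx f's //; apply: Gt0 => //; last by rewrite wx.
    by apply: open_t_sphere => //; rewrite wx.
  have cB : c \in B by rewrite BE !inE negb_or cs ct.
  by rewrite f'B; [apply: (adapted_node gf cB) | exists c].
Qed.

End OneCollapse.
End Expansions.

(** * Induction over the collapse *)

Section CollapseInduction.
Variables (R : realType) (X : topologicalType) (K : regular_cw R X).
Local Notation pt := (bool -> nat -> R).
Implicit Types (A B : {set K}) (c d s t : K).

Section Step.
Variables (A B : {set K}) (s t : K).
Hypotheses (subA : subcomplex A) (subB : subcomplex B).
Hypotheses (sA : s \in A) (face_ts : face t s).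
Hypothesis dim_s : cell_dim s = (cell_dim t).+1.
Hypothesis BE : B = (A :\: [set s; t])%SET.

(** The edge [s] is laid along a new edge of the first tree, starting at the
    image of its endpoint [- w0] that is not the free vertex. *)
Lemma expand_edge N f : adapted B N f -> cell_dim t = 0%N ->
  exists N' f', adapted A N' f'.
Proof.
move=> gf t0; have s1 : cell_dim s = 1%N by rewrite dim_s t0.
have open_t0 : open_disc R (cell_dim t) 0.
  by rewrite /open_disc /= -(scale0r 0) sqnormZ expr0n mul0r ltr01.
pose y := char_map (c := t) 0.
have yt : open_cell t y by exact: (imageP (char_map (c := t)) open_t0).
have open_tE x : open_cell t x -> x = y.
  move=> [u _ <-]; congr char_map; apply/rowP => i.
  by have := ltn_ord i; rewrite {2}t0.
have [w0 w0_sphere w0y] := closed_t_sphere face_ts dim_s (open_cell_sub yt).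
have [tau [ctau tau_inj tau01 [tau0 tau1] sphereE]] := interval_coordinate s1 w0_sphere.
have sphere_disc w : unit_sphere R (cell_dim s) w -> closed_disc R (cell_dim s) w.
  by rewrite /unit_sphere /closed_disc /= => ->.
have Nw0_sphere : unit_sphere R _ (- w0).
  by rewrite -scaleN1r /unit_sphere /= sqnormZ w0_sphere mulr1 sqrrN expr1n.
have w0_neq : - w0 <> w0.
  by move=> E; move: tau0; rewrite E tau1 => /eqP; rewrite oner_eq0.
pose x1 := char_map (c := s) (- w0).
have x1B : carrier B x1.
  case: (sphere_s_cases subA sA BE Nw0_sphere) => // /open_tE E.
  by case: w0_neq; apply: (char_map_inj (sphere_disc _ Nw0_sphere) (sphere_disc _ w0_sphere));
     rewrite w0y.
have node_x1 : node (f x1).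
  have [d /= ds dx] := cell_boundary (imageP (char_map (c := s)) Nw0_sphere).
  apply: (adapted_node_below gf x1B _ dx).
  by move: ds; rewrite s1 ltnS leqn0 => /eqP.
have [k fk] := node_x1 true; have [l fl] := node_x1 false.
have [i Ni ik] := attach_fresh k N.
have f_sub := adapted_subtree gf x1B.
have carrierB_w1 w : closed_disc R _ w -> carrier B (char_map (c := s) w) -> w = - w0.
  move=> w1 wB; case: (sphereE _ (carrierB_sphere BE w1 wB)) => // E.
  have [_ []] := carrierB_not_open BE wB.
  by rewrite E w0y.
have open_t_w0 w : unit_sphere R _ w -> open_cell t (char_map (c := s) w) -> w = w0.
  move=> w1 /open_tE E; apply: (char_map_inj (sphere_disc _ w1) (sphere_disc _ w0_sphere)).
  by rewrite w0y.
have fki : f x1 true = vert R (attach i) by rewrite ik.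
pose G w := climb (f x1) true i (tau w).
exists i.+1; apply: (extend_over_cell subA subB sA face_ts dim_s BE (G := G) gf).
- exact: leqW.
- move=> e j.
  have cG : cwise_continuous G.
    apply: (@cwise_continuous_climb R _ (fun=> f x1) tau) => //.
    by move=> e' j'; exact: continuous_cst_fun.
  by apply: continuous_subspaceT; exact: cG.
- move=> w /tau01 tw; exact: climb_subtree.
- move=> w w' w1 w'1 /(congr1 (fun p : pt => p true i)).
  by rewrite /G !climbE => /addrI/tau_inj.
- by move=> w w1 /(carrierB_w1 _ w1) ->; rewrite /G tau0 climb0.
- move=> w w1 wB; exists true, i; split=> //; rewrite /G climbE.
  rewrite (subtree2_ge _ f_sub) // add0r; apply/eqP => tw0; apply: wB.
  by rewrite (tau_inj w (- w0)) // tw0.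
- by move=> w _ _; exists false; rewrite /G climb_other //; exists l.
- by move=> w _ _ _; exists false; rewrite /G climb_other //; exists l.
- move=> w w1 wt _; rewrite (open_t_w0 w w1 wt) => -[].
    by rewrite /G climb_edge // tau1 edge1; exists i.+1.
  by rewrite /G climb_other //; exists l.
Qed.

(** The path [al] is the image of the arc along which the disc [s] is attached;
    it is a staircase, and the strip attached to it is the image of the disc. *)
Lemma expand_disc N f : adapted B N f -> cell_dim t = 1%N ->
  exists N' f', adapted A N' f'.
Proof.
move=> gf t1; have s2 : cell_dim s = 2%N by rewrite dim_s t1.
have t_sphere : closed_cell t `<=` char_map (c := s) @` unit_sphere R _.
  exact: (closed_t_sphere face_ts dim_s).
have [be [q [cbe be_inj beP [be_0 be_1] [cq1 cq2 [qsq q_inj] q_open q_be]]]] :=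
  free_arc s2 t1 (cw_hausdorff K) (char_map_embedding s) (char_map_embedding t) t_sphere.
have sphere_disc w : unit_sphere R (cell_dim s) w -> closed_disc R (cell_dim s) w.
  by rewrite /unit_sphere /closed_disc /= => ->.
pose cl01 (u : R) : R := Num.max 0 (Num.min 1 u).
have cl01E u : 0 <= u <= 1 -> cl01 u = u.
  by move=> /andP[u0 u1]; rewrite /cl01 min_r // max_r.
have cl01_in u : 0 <= cl01 u <= 1.
  by rewrite /cl01 le_max lexx ge_max ge_min lexx ler01.
pose ga u := char_map (c := s) (be (cl01 u)).
have gaB u : carrier B (ga u).
  have [b1 _ nb] := beP _ (cl01_in u).
  by case: (sphere_s_cases subA sA BE b1).
pose al u := f (ga u).
have ccl : {within setT, continuous cl01}.
  by apply: continuous_subspaceT; rewrite /cl01; cont.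
have cbecl : {within setT, continuous (fun u => be (cl01 u))}.
  apply: (comp_within_continuous ccl cbe) => u _.
  by apply/segmentP; exact: cl01_in.
have cga : {within setT, continuous ga}.
  have [cs _ _] := char_map_embedding s.
  apply: (comp_within_continuous cbecl cs) => u _.
  by have [b1 _ _] := beP _ (cl01_in u); exact: sphere_disc.
have cal : cwise_continuous al.
  move=> e j; apply/continuous_subspace_setT.
  apply: (comp_within_continuous cga (@adapted_continuous _ _ _ _ _ _ gf e j)) => u _.
  exact: gaB.
have al_sub u : subtree2 N (al u) by exact: (adapted_subtree gf (gaB u)).
have al_inj u v : 0 <= u <= 1 -> 0 <= v <= 1 -> al u = al v -> u = v.
  move=> uI vI /(adapted_inj gf (gaB u) (gaB v)) E.
  have [bu _ _] := beP _ (cl01_in u); have [bv _ _] := beP _ (cl01_in v).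
  have /be_inj := char_map_inj (sphere_disc _ bu) (sphere_disc _ bv) E.
  by move=> /(_ (cl01_in u) (cl01_in v)); rewrite !cl01E.
have al_grid u : grid (al u).
  have [bu _ _] := beP _ (cl01_in u).
  have [d /= ds dx] := cell_boundary (imageP (char_map (c := s)) bu).
  apply: (adapted_grid_below gf (gaB u) _ dx).
  by move: ds; rewrite s2 ltnS.
have al_end u : (char_map (c := t) @` unit_sphere R _) (ga u) -> node (al u).
  move=> [z z1 zE]; have [zB [d [dt dx]]] := sphere_t_cases subA sA face_ts dim_s BE z1.
  apply: (adapted_node_below gf (gaB u) _ (c := d)); last by rewrite -zE.
  by move: dt; rewrite t1 ltnS leqn0 => /eqP.
have n0 : node (al 0) by apply: al_end; rewrite /ga cl01E // lexx ler01.
have n1 : node (al 1) by apply: al_end; rewrite /ga cl01E // lexx ler01.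
have [n [e stair]] : exists n e, staircase n e al 1.
  by apply: (@grid_path_staircase R N al) => //; move=> u _; exact: al_sub.
have [N' [F [NN' cF FN' inj_F F_bot F_off F_sides]]] :=
  strip_exists cal (fun u _ => al_sub u) al_inj n0 n1 stair.
exists N'; apply: (extend_over_cell subA subB sA face_ts dim_s BE (G := fun w => F (q w)) gf).
- exact: NN'.
- move=> e' j.
  have -> : (fun w => F (q w) e' j) = (fun w => (fun z => F z e' j) ((q w).1, (q w).2)).
    by apply/funext => w; rewrite -surjective_pairing.
  by apply: (@continuous_comp2 _ _ (fun z => F z e' j)) => //; exact: cF.
- by move=> w /qsq; exact: FN'.
- by move=> w w' w1 w'1 /inj_F E; apply: q_inj => //; apply: E; exact: qsq.
- move=> w w1 wB; have [_ nt] := carrierB_not_open BE wB.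
  have [u uI wE] := q_be w (carrierB_sphere BE w1 wB) nt.
  have [_ qE _] := beP u uI.
  by rewrite wE qE F_bot // /al /ga cl01E.
- move=> w w1 wB; apply: F_off; first exact: qsq.
  have [/andP[q1 q1'] /andP[q2 _]] := qsq w w1.
  rewrite lt_neqAle q2 andbT; apply/eqP => q20; apply: wB.
  have qI : 0 <= (q w).1 <= 1 by rewrite q1.
  have [b1 bE _] := beP _ qI.
  have -> : w = be (q w).1.
    apply: q_inj => //; first exact: sphere_disc.
    by rewrite bE [LHS]surjective_pairing -q20.
  by have := gaB (q w).1; rewrite /ga cl01E.
- by move=> w _; rewrite s2.
- by move=> w w1 wt _; apply: F_sides; [apply/qsq/sphere_disc | exact: q_open].
- by move=> w _ _; rewrite t1.
Qed.

End Step.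

Lemma adapted_vertex v : cell_dim v = 0%N -> exists N f, @adapted R X K [set v]%SET N f.
Proof.
move=> v0; exists 1%N, (fun=> fun=> vert R 0).
have one x y : @carrier R X K [set v]%SET x -> @carrier R X K [set v]%SET y -> x = y.
  move=> [d /=]; rewrite inE => /eqP-> [u _ <-] [d' /=]; rewrite inE => /eqP-> [u' _ <-].
  congr char_map; apply/rowP => i.
  by have := ltn_ord i; rewrite {2}v0.
split.
- by move=> e j; apply: continuous_subspaceT; exact: continuous_cst_fun.
- by move=> x _ e; exact: subtree_vert.
- by move=> x y xv yv _; exact: one.
- by move=> c x _ _ _; exists true, 0%N.
- by move=> c x _ _ _ e; exists 0%N.
Qed.

Lemma adapted_collapses A v : (forall c, (cell_dim c <= 2)%N) -> cell_dim v = 0%N ->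
  @collapses R X K A [set v]%SET -> exists N f, adapted A N f.
Proof.
move=> dim2 v0; set B : {set K} := [set v]%SET => coll.
have : exists N f, adapted B N f by exact: adapted_vertex.
elim: coll => // {}A A' {}B [subA [subA' [s [t [[sA tA ts dim_s] [_ A'E]]]]]] _ IH gB.
have [N [f gf]] := IH gB.
have : (cell_dim t <= 1)%N by have := dim2 s; rewrite dim_s ltnS.
case E : (cell_dim t) => [|[|]] // _.
  exact: (expand_edge subA subA' sA ts dim_s A'E gf E).
exact: (expand_disc subA subA' sA ts dim_s A'E gf E).
Qed.

End CollapseInduction.

(** * Finite subtrees are trees *)

Section Embeddings.

Lemma hausdorff_by_functions (R : realType) (T : topologicalType) :
  (forall x y : T, x <> y -> exists2 g : T -> R, continuous g & g x <> g y) ->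
  hausdorff_space T.
Proof.
move=> sep; rewrite open_hausdorff => x y /eqP/sep[g cg /eqP gxy].
have := @Rhausdorff R; rewrite open_hausdorff => /(_ _ _ gxy)[[U V] /= [xU yV] [oU oV UV]].
exists (g @^-1` U, g @^-1` V) => /=.
  by split; apply/mem_set; [exact: (set_mem xU) | exact: (set_mem yV)].
split; [by apply: open_comp => // ? _; exact: cg | by apply: open_comp => // ? _; exact: cg |].
apply/eqP; rewrite -preimage_setI; move/eqP: UV => ->.
exact: preimage_set0.
Qed.

Lemma compact_embedding (T U : topologicalType) (A : set T) (f : T -> U) :
  hausdorff_space U -> compact A -> {within A, continuous f} ->
  (forall x y, A x -> A y -> f x = f y -> x = y) -> embedding_on A f.
Proof.
move=> hU cA cf inj_f; split=> // [x y /set_mem Ax /set_mem Ay|O oO].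
  exact: inj_f.
exists (~` (f @` (A `&` ~` O))).
  apply: closed_openC; apply: compact_closed => //.
  apply: continuous_compact; last by apply: compact_closedI => //; exact: open_closedC.
  by apply: continuous_subspaceW cf => x [].
apply/seteqP; split=> x [Ax].
  move=> Ox; split=> // -[y [Ay nOy]] /inj_f E; apply: nOy.
  by rewrite E.
move=> nfx; split=> //; apply: contrapT => nOx; apply: nfx.
by exists x.
Qed.

End Embeddings.

Section FiniteTrees.
Variable R : realType.

Lemma continuous_ptws (T : topologicalType) (f : T -> {ptws nat -> R}) :
  (forall j, continuous (fun x => f x j)) -> continuous f.
Proof.
move=> cf x; apply/cvg_sup => j U [? [[W oW <-]] /= Wfx] /filterS; apply.
by apply: (cf j x); exact: open_nbhs_nbhs.
Qed.

Variable M : nat.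
Local Notation N := M.+1.

(** Having at least one edge, this space is a graph of dimension exactly 1. *)
Definition tree_space : topologicalType :=
  set_type (subtree N : set {ptws nat -> R}).

Lemma subtree_root : (subtree N : set {ptws nat -> R}) (vert R 0).
Proof. exact: subtree_vert. Qed.

Definition tree_root : tree_space := exist _ (vert R 0) (mem_set subtree_root).

(** The value outside the subtree is junk. *)
Definition to_tree (y : nat -> R) : tree_space := insubd tree_root y.

Lemma to_treeK y : subtree N y -> val (to_tree y) = y.
Proof. by move=> yN; rewrite /to_tree insubdK //; exact: mem_set. Qed.

Lemma tree_subtree (x : tree_space) : subtree N (val x).
Proof. exact: set_valP x. Qed.

Lemma tree_inj (x y : tree_space) : (forall j, val x j = val y j) -> x = y.
Proof. by move=> E; apply: val_inj; apply/funext. Qed.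

Lemma tree_coord_continuous j : continuous (fun x : tree_space => val x j).
Proof.
move=> x; apply: (@continuous_comp _ {ptws nat -> R} R (val : tree_space -> _) (fun y => y j)).
  exact: initial_continuous.
exact: (@proj_continuous nat (fun=> R) j).
Qed.

Lemma continuous_to_tree (T : topologicalType) (f : T -> tree_space) :
  (forall j, continuous (fun x => val (f x) j)) -> continuous f.
Proof.
move=> cf; apply: continuous_comp_initial.
exact: continuous_ptws.
Qed.

Lemma tree_hausdorff : hausdorff_space tree_space.
Proof.
apply: (@hausdorff_by_functions R) => x y xy.
have [j xyj] : exists j, val x j <> val y j.
  apply: contrapT => none; apply: xy; apply: tree_inj => j; apply: contrapT => xyj.
  by apply: none; exists j.
by exists (fun z : tree_space => val z j) => //; exact: tree_coord_continuous.
Qed.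

Definition tree_cell : finType := ('I_N.+1 + 'I_N)%type.

Definition tree_cell_dim (c : tree_cell) : nat := if c is inl _ then 0 else 1.

Definition tree_char_map (c : tree_cell) : 'rV[R]_(tree_cell_dim c) -> tree_space :=
  match c with
  | inl k => fun=> to_tree (vert R k)
  | inr i => fun w => to_tree (edge i ((1 + w ord0 ord0) / 2))
  end.

Lemma half_range (w : 'rV[R]_1) : closed_disc R 1 w -> 0 <= (1 + w ord0 ord0) / 2 <= 1.
Proof. by rewrite (rV1E w) /closed_disc /= sqnorm1 le1_sqr mxE; lra. Qed.

Lemma half_range_open (w : 'rV[R]_1) : open_disc R 1 w -> 0 < (1 + w ord0 ord0) / 2 < 1.
Proof. by rewrite (rV1E w) /open_disc /= sqnorm1 lt1_sqr mxE; lra. Qed.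

Lemma edge_subtree (i : 'I_N) (t : R) : 0 <= t <= 1 -> subtree N (edge i t).
Proof. by move=> tI; exists i, t; split. Qed.

Lemma vert_subtree (k : 'I_N.+1) : subtree N (vert R k).
Proof. by apply: subtree_vert => //; rewrite -ltnS. Qed.

Lemma edge_continuous (i : 'I_N) : {within `[0, 1], continuous (fun t => to_tree (edge i t))}.
Proof.
apply: continuous_to_tree => j.
have c : {within `[0, 1], continuous (fun t : R => edge i t j)}.
  by apply: continuous_subspaceT; rewrite /edge; cont.
apply: (subspace_eq_continuous _ c) => t /set_mem/segmentP tI.
have E : val (to_tree (edge i t)) = edge i t by rewrite to_treeK //; exact: edge_subtree.
exact: (congr1 (@^~ j) (esym E)).
Qed.

Lemma edge_inj_t (i : nat) (t t' : R) : edge i t = edge i t' -> t = t'.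
Proof. by move=> /(congr1 (@^~ i)); rewrite !edgeE. Qed.

Lemma rV0_disc (w : 'rV[R]_0) : sqnorm w = 0.
Proof. by rewrite /sqnorm big_ord0. Qed.

Lemma tree_char_embedding c :
  embedding_on (closed_disc R (tree_cell_dim c)) (@tree_char_map c).
Proof.
apply: compact_embedding; [exact: tree_hausdorff | exact: compact_closed_disc | |].
  case: c => [k|i] /=.
    by apply: continuous_subspaceT; exact: cst_continuous.
  have cw : {within closed_disc R 1,
      continuous (fun w : 'rV[R]_1 => (1 + w ord0 ord0) / 2)}.
    by apply: continuous_subspaceT; have c := @coord_continuous R 1 1 ord0 ord0; cont.
  apply: (comp_within_continuous cw (@edge_continuous i)) => w /half_range tI.
  by apply/segmentP.
case: c => [k|i] /= w w' w1 w'1; first by move=> _; apply/rowP => i; have := ltn_ord i.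
move=> /(congr1 val); rewrite !to_treeK; try exact/edge_subtree/half_range.
move=> /edge_inj_t E; rewrite (rV1E w) (rV1E w'); congr const_mx; lra.
Qed.

Lemma tree_vertex_in_cell (k : 'I_N.+1) :
  (@tree_char_map (inl k) @` open_disc R 0) (to_tree (vert R k)).
Proof. by exists 0 => //; rewrite /open_disc /= rV0_disc ltr01. Qed.

Lemma tree_cells_cover (x : tree_space) :
  exists c : tree_cell, (@tree_char_map c @` open_disc R (tree_cell_dim c)) x.
Proof.
have [i [t [iN /andP[t0 t1] xE]]] := tree_subtree x.
have vert_cell k : (k < N.+1)%N -> val x = vert R k ->
    exists c : tree_cell, (@tree_char_map c @` open_disc R (tree_cell_dim c)) x.
  move=> kN xk; exists (inl (Ordinal kN)).
  have -> : x = to_tree (vert R k).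
    apply: val_inj; rewrite to_treeK //; exact: (vert_subtree (Ordinal kN)).
  exact: (tree_vertex_in_cell (Ordinal kN)).
have [t_0|tN0] := eqVneq t 0.
  apply: (vert_cell (attach i)); last by rewrite xE t_0 edge0.
  by rewrite ltnS (leq_trans (attach_le i)) // ltnW.
have [t_1|tN1] := eqVneq t 1.
  by apply: (vert_cell i.+1) => //; rewrite xE t_1 edge1.
exists (inr (Ordinal iN)); exists (const_mx (2 * t - 1)).
  rewrite /open_disc /= sqnorm1 lt1_sqr.
  have : 0 < t by rewrite lt_neqAle eq_sym tN0.
  have : t < 1 by rewrite lt_neqAle tN1.
  by lra.
apply: val_inj; rewrite /tree_char_map /= to_treeK mxE.
  have -> : (1 + (2 * t - 1)) / 2 = t by lra.
  by rewrite xE.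
have -> : (1 + (2 * t - 1)) / 2 = t by lra.
by exists i, t; rewrite t0 t1; split.
Qed.

Lemma vert_neq_edge k i (t : R) : 0 < t < 1 -> vert R k <> edge i t.
Proof.
move=> tI E; have := vert01 R k i; rewrite E edgeE => /eqP.
by rewrite mulf_eq0 subr_eq0 => /orP[]/eqP ?; lra.
Qed.

Lemma tree_cells_disjoint (c d : tree_cell) (x : tree_space) :
  (@tree_char_map c @` open_disc R (tree_cell_dim c)) x ->
  (@tree_char_map d @` open_disc R (tree_cell_dim d)) x -> c = d.
Proof.
have closedI (w : 'rV[R]_1) : open_disc R 1 w -> 0 <= (1 + w ord0 ord0) / 2 <= 1.
  by move=> /half_range_open; lra.
case: c d => [k|i] [l|j] [w w1 <-] [w' w'1] /(congr1 val) /=.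
- rewrite !to_treeK; try exact: vert_subtree.
  by move=> /vert_inj/val_inj ->.
- rewrite !to_treeK; [|exact: vert_subtree | exact/edge_subtree/closedI].
  by move=> /esym/vert_neq_edge; case; exact: half_range_open.
- rewrite !to_treeK; [|exact/edge_subtree/closedI|exact: vert_subtree].
  by move=> /vert_neq_edge; case; exact: half_range_open.
- rewrite !to_treeK; try exact/edge_subtree/closedI.
  have [t0 _] := andP (half_range_open w1); have [t'0 _] := andP (half_range_open w'1).
  by move=> /(edge_inj t'0 t0)[/val_inj ->].
Qed.

Lemma tree_cell_boundary (c : tree_cell) :
  @tree_char_map c @` unit_sphere R (tree_cell_dim c) `<=`
  \bigcup_(d in [set d : tree_cell | (tree_cell_dim d < tree_cell_dim c)%N])
    (@tree_char_map d @` open_disc R (tree_cell_dim d)).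
Proof.
case: c => [k|i] x [w].
  by rewrite /unit_sphere /= rV0_disc => /eqP; rewrite eq_sym oner_eq0.
rewrite (rV1E w) /unit_sphere /= sqnorm1 mxE => /eqP.
rewrite -[X in _ == X](expr1n _ 2) eqf_sqr => /orP[]/eqP -> <-.
  have iN : (i.+1 < N.+1)%N by rewrite ltnS.
  exists (inl (Ordinal iN)) => //.
  have -> : (1 + 1) / 2 = 1 :> R by lra.
  by rewrite edge1; exact: (tree_vertex_in_cell (Ordinal iN)).
have iN : (attach i < N.+1)%N.
  by rewrite ltnS (leq_trans (attach_le i)) // ltnW.
exists (inl (Ordinal iN)) => //.
rewrite addrN mul0r edge0; exact: (tree_vertex_in_cell (Ordinal iN)).
Qed.

Definition tree_cw : regular_cw R tree_space :=
  @RegularCW R tree_space tree_cell tree_cell_dim tree_char_map tree_hausdorff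
    tree_char_embedding tree_cells_cover tree_cells_disjoint tree_cell_boundary.

Lemma tree_graph : graph R tree_space.
Proof.
exists tree_cw; split; first by case.
by exists (inr ord0).
Qed.

(** The [n]-th edge is connected and meets the union of the earlier ones at the
    vertex [attach n]. *)
Lemma tree_connected : connected [set: tree_space].
Proof.
pose E (i : nat) : set tree_space := [set x | exists2 t, 0 <= t <= 1 & val x = edge i t].
have E_connected (i : 'I_N) : connected (E i).
  have -> : E i = (fun t => to_tree (edge i t)) @` `[0, 1].
    apply/seteqP; split=> x.
      move=> [t tI xE]; exists t; first exact/segmentP.
      by apply: val_inj; rewrite to_treeK // -xE; exact: tree_subtree.
    move=> [t /segmentP tI <-]; exists t => //.
    by rewrite to_treeK //; exact: edge_subtree.
  by apply: connected_continuous_connected; [exact: segment_connected | exact: edge_continuous].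
have vertE (k : 'I_N.+1) : val (to_tree (vert R k)) = vert R k.
  by apply: to_treeK; exact: vert_subtree.
have I0 : 0 <= (0 : R) <= 1 by lra.
have I1 : 0 <= (1 : R) <= 1 by lra.
suff H n : (n < N)%N ->
    connected [set x : tree_space | exists2 i, (i <= n)%N & E i x].
  have -> : [set: tree_space] = [set x | exists2 i, (i <= M)%N & E i x].
    apply/seteqP; split=> x // _.
    by have [i [t [iN tI xE]]] := tree_subtree x; exists i => //; exists t.
  exact: H.
elim: n => [|n IH] nN.
  have -> : [set x | exists2 i, (i <= 0)%N & E i x] = E (@ord0 M).
    apply/seteqP; split=> x; first by move=> [i]; rewrite leqn0 => /eqP ->.
    by exists 0%N.
  exact: E_connected.
have -> : [set x | exists2 i, (i <= n.+1)%N & E i x] =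
    [set x | exists2 i, (i <= n)%N & E i x] `|` E (Ordinal nN).
  apply/seteqP; split=> x.
    move=> [i]; rewrite leq_eqVlt => /orP[/eqP -> Ex|il Ex]; first by right.
    by left; exists i.
  by move=> [[i il Ex]|Ex]; [exists i => //; exact: leqW | exists n.+1].
have aN : (attach n.+1 < N.+1)%N.
  by rewrite ltnS (leq_trans (attach_le _)) // ltnW.
apply: connectedU; [|exact/IH/ltnW|exact: E_connected].
exists (to_tree (vert R (attach n.+1))); split; last first.
  by exists 0 => //; rewrite (vertE (Ordinal aN)) edge0.
rewrite /=; have := attach_le n.+1; case E' : (attach n.+1) => [|a] an.
  exists 0%N => //; exists 0 => //.
  by rewrite -E' (vertE (Ordinal aN)) /= E' edge0.
have a_n : (a <= n)%N.
  by rewrite -ltnS -E'; rewrite /attach; have := ltn_logl 2 (ltn0Sn n.+1);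
     rewrite /attach in E'; rewrite E'.
exists a => //; exists 1 => //.
by rewrite -E' (vertE (Ordinal aN)) /= E' edge1.
Qed.

Lemma circle_connected : connected (unit_sphere R 2).
Proof.
have sq a b : sqnorm (vec2 a b) = a ^+ 2 + b ^+ 2 :> R by rewrite sqnorm2 vec2_0 vec2_1.
pose z1 : 'rV[R]_2 := vec2 1 0; pose z2 : 'rV[R]_2 := vec2 (-1) 0.
have z1S : unit_sphere R 2 z1 by rewrite /unit_sphere /= sq; ring.
have z2S : unit_sphere R 2 z2 by rewrite /unit_sphere /= sq; ring.
have neq (a b : 'rV[R]_2) : a ord0 ord0 <> b ord0 ord0 -> a <> b.
  by move=> h E; rewrite E in h.
have -> : unit_sphere R 2 = (unit_sphere R 2 `\ z1) `|` (unit_sphere R 2 `\ z2).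
  apply/seteqP; split=> z; last by case=> -[].
  move=> zS; have [zz1|zz1] := pselect (z = z1); last by left.
  by right; split=> //; rewrite zz1; apply: neq; rewrite !vec2_0; lra.
apply: connectedU; try exact: circle_minus_point_connected.
exists (vec2 0 1); split; split; try (by rewrite /unit_sphere /= sq; ring);
  by apply: neq; rewrite !vec2_0; lra.
Qed.

(** Consider the last height [h j] that is not identically zero on the curve.
    Where it is positive, the point of the tree lies on the [j]-th edge and is
    determined by [h j].  Hence, if [h j z] is positive, [h j] does not take this
    value on the circle minus [z], which is connected; so [h j z] cannot be strictly
    between two other values.  As the circle is connected this forces [h j] to be
    constant, contradicting injectivity. *)
Lemma tree_no_closed_curve : ~ has_simple_closed_curve R tree_space.
Proof.
move=> [f [cf inj_f _]].
have f_inj z z' : unit_sphere R 2 z -> unit_sphere R 2 z' -> f z = f z' -> z = z'.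
  by move=> h h' E; apply: (inj_f z z') => //; exact/mem_set.
pose h j z := val (f z) j.
have ch j : {within unit_sphere R 2, continuous (h j)}.
  move=> z; apply: (@continuous_comp _ _ _ (f : subspace (unit_sphere R 2) -> _)
    (fun x : tree_space => val x j)); first exact: cf.
  exact: tree_coord_continuous.
(* Descending induction on the height, counted from the top. *)
suff all0 k : forall j, (N - k <= j)%N -> forall z, unit_sphere R 2 z -> h j z = 0.
  have sq a b : sqnorm (vec2 a b) = a ^+ 2 + b ^+ 2 :> R by rewrite sqnorm2 vec2_0 vec2_1.
  have z1S : unit_sphere R 2 (vec2 1 0) by rewrite /unit_sphere /= sq; ring.
  have z2S : unit_sphere R 2 (vec2 (-1) 0) by rewrite /unit_sphere /= sq; ring.
  have : vec2 1 0 = vec2 (-1) 0 :> 'rV[R]_2.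
    apply: f_inj => //; apply: tree_inj => j.
    by rewrite -/(h j _) -/(h j (vec2 (-1) 0)) !(all0 N j) // subnn.
  by move=> /(congr1 (fun z : 'rV[R]_2 => z ord0 ord0)); rewrite !vec2_0; lra.
elim: k => [|k IH] j.
  by rewrite subn0 => Nj z _; exact: subtree_ge (tree_subtree _) Nj.
move=> kj; have [kj'|jk] := leqP (N - k) j; first exact: IH.
have above j' z : unit_sphere R 2 z -> (j < j')%N -> h j' z = 0.
  move=> zS jj'; apply: IH => //; apply: leq_trans jj'.
  by rewrite leq_subLR -addSnnS -leq_subLR.
have h_ge0 z : unit_sphere R 2 z -> 0 <= h j z.
  move=> _; rewrite /h; have [i [t [_ /andP[t0 _] ->]]] := tree_subtree (f z).
  rewrite /edge; apply: addr_ge0; last by apply: mulr_ge0 => //; exact: ler0n.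
  have /eqP := vert01 R (attach i) j; rewrite mulf_eq0 subr_eq0 => /orP[]/eqP.
    by move=> ->.
  by move=> <-; exact: ler01.
have on_edge z : unit_sphere R 2 z -> 0 < h j z -> val (f z) = edge j (h j z).
  move=> zS hz; have [i [t [iN /andP[t0 t1] fE]]] := tree_subtree (f z).
  have hE j' : h j' z = edge i t j' by rewrite /h fE.
  have [ij|ji|ij] := ltngtP i j.
  - by move: hz; rewrite hE edge_gt // ltxx.
  - have ti0 : t = 0 by rewrite -(above i z zS ji) hE edgeE.
    have : val (f z) = vert R (attach i) by rewrite fE ti0 edge0.
    case Ea : (attach i) => [|a] fa.
      by move: hz; rewrite /h fa vert0 ltxx.
    have [aj|ja|aj] := ltngtP a j.
    + by move: hz; rewrite /h fa vert_ge ?ltxx.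
    + have /eqP := above a z zS ja.
      by rewrite /h fa vertE oner_eq0.
    + by rewrite /h fa -aj vertE -edge1.
  - by rewrite /h fE -ij edgeE.
have h_inj z z' : unit_sphere R 2 z -> unit_sphere R 2 z' -> 0 < h j z ->
    h j z = h j z' -> z = z'.
  move=> zS z'S hz hzz'; apply: f_inj => //; apply: val_inj.
  by rewrite (on_edge z) // (on_edge z') -?hzz'.
have h_between z y y' : unit_sphere R 2 z -> unit_sphere R 2 y -> unit_sphere R 2 y' ->
    0 < h j z -> h j y < h j z < h j y' -> False.
  move=> zS yS y'S hz /andP[yz zy'].
  have /connected_intervalP itv : connected (h j @` (unit_sphere R 2 `\ z)).
    apply: connected_continuous_connected; first exact: circle_minus_point_connected.
    by apply: continuous_subspaceW (ch j) => ? [].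
  have [|||w [wS wz] hw] := itv (h j y) (h j y') _ _ (h j z).
  - by exists y => //; split=> // E; rewrite E ltxx in yz.
  - by exists y' => //; split=> // E; rewrite E ltxx in zy'.
  - by rewrite !ltW.
  - by apply: wz; apply/esym; apply: h_inj.
move=> z zS; apply/eqP; rewrite eq_le h_ge0 // andbT leNgt; apply/negP => hz.
have NzS : unit_sphere R 2 (- z).
  by rewrite -scaleN1r /unit_sphere /= sqnormZ zS mulr1 sqrrN expr1n.
have Nzz : - z <> z.
  move=> E; have z0 : z = 0.
    apply/rowP => i; have := congr1 (fun w : 'rV[R]_2 => w ord0 i) E.
    by rewrite !mxE; lra.
  by have := zS; rewrite /unit_sphere /= z0 -(scale0r 0) sqnormZ expr0n mul0r; lra.
have hNz : h j (- z) != h j z.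
  by apply/eqP => E; apply: Nzz; apply/esym; apply: h_inj => //.
have mid_hit a b : unit_sphere R 2 a -> unit_sphere R 2 b -> h j a < h j b -> False.
  move=> aS bS ab; have /connected_intervalP itv : connected (h j @` unit_sphere R 2).
    by apply: connected_continuous_connected; [exact: circle_connected | exact: ch].
  have [|||w wS hw] := itv (h j a) (h j b) _ _ ((h j a + h j b) / 2).
  - by exists a.
  - by exists b.
  - by apply/andP; split; lra.
  - have ha0 := h_ge0 a aS.
    by apply: (h_between w a b) => //; rewrite hw; [|apply/andP; split]; lra.
by move: hNz; rewrite neq_lt => /orP[]; exact: mid_hit.
Qed.

Lemma tree_space_tree : tree R tree_space.
Proof. by split; [exact: tree_graph | exact: tree_connected | exact: tree_no_closed_curve]. Qed.

End FiniteTrees.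

(** * The embedding *)

Lemma carrier_setT (R : realType) (X : topologicalType) (K : regular_cw R X) :
  carrier [set: K]%SET = [set: X].
Proof.
apply/seteqP; split=> x // _; have [c cx] := open_cells_cover K x.
by exists c => //=; rewrite inE.
Qed.

Lemma cw_compact (R : realType) (X : topologicalType) (K : regular_cw R X) :
  compact [set: X].
Proof.
have -> : [set: X] = \bigcup_(c in [set: K]) closed_cell c.
  apply/seteqP; split=> x // _; have [c /open_cell_sub cx] := open_cells_cover K x.
  by exists c.
rewrite -bigsetU_fset_set; last exact: finite_finset.
by apply: bigsetU_compact => c _; exact: closed_cell_compact.
Qed.

Theorem theorem1p9 (R : realType) (X : topologicalType)
  (hdim : polyhedron_of_dim R 2 X) (hcoll : collapsible R X) :
  exists T1 T2 : topologicalType,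
    tree R T1 /\ tree R T2 /\ embeds_in X (T1 * T2)%type.
Proof.
have [K [v [v0 coll]]] := hcoll.
have [N [f gf]] := adapted_collapses (fun c => cell_dim_le2 c hdim) v0 coll.
have carrier_all x : carrier [set: K]%SET x by rewrite carrier_setT.
have f_sub x d : subtree N.+1 (f x d).
  exact: subtreeW (leqnSn N) (adapted_subtree gf (carrier_all x) d).
exists (tree_space R N), (tree_space R N).
split; first exact: tree_space_tree.
split; first exact: tree_space_tree.
pose F x := (to_tree N (f x true), to_tree N (f x false)).
have FK d x : val (to_tree N (f x d)) = f x d by exact: to_treeK.
have cF d : continuous (fun x => to_tree N (f x d)).
  apply: continuous_to_tree => j.
  have -> : (fun x => val (to_tree N (f x d)) j) = (fun x => f x d j).
    by apply/funext => x; rewrite FK.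
  apply/continuous_subspace_setT; rewrite -(carrier_setT K).
  exact: adapted_continuous gf d j.
exists F; apply: compact_embedding.
- apply: (@hausdorff_by_functions R) => -[a b] [a' b'] ab.
  have [aa'|aa'] := pselect (a = a').
    have [j bj] : exists j, val b j <> val b' j.
      apply: contrapT => none; apply: ab; rewrite aa'; congr (_, _).
      by apply: tree_inj => j; apply: contrapT => h; apply: none; exists j.
    exists (fun z : tree_space R N * tree_space R N => val z.2 j) => // z.
    apply: (@continuous_comp _ _ _ snd (fun y : tree_space R N => val y j)).
      exact: cvg_snd.
    exact: tree_coord_continuous.
  have [j aj] : exists j, val a j <> val a' j.
    apply: contrapT => none; apply: aa'.
    by apply: tree_inj => j; apply: contrapT => h; apply: none; exists j.
  exists (fun z : tree_space R N * tree_space R N => val z.1 j) => // z.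
  apply: (@continuous_comp _ _ _ fst (fun y : tree_space R N => val y j)).
    exact: cvg_fst.
  exact: tree_coord_continuous.
- exact: cw_compact K.
- apply: continuous_subspaceT => x U UFx.
  exact: (cvg_pair (cF true x) (cF false x) UFx).
- move=> x y _ _ [/(congr1 val) E1 /(congr1 val) E2].
  apply: (adapted_inj gf) => //; apply/funext => -[].
    by rewrite -(FK true) E1 FK.
  by rewrite -(FK false) E2 FK.
Qed.
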